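(* Let $(X^\circ,\xi^\circ)$ be mass-stationary under $\mathbf P^\circ$ and suppose that $\operatorname{conv}(\operatorname{supp}\xi^\circ)=\mathbb R^d$ $\mathbf P^\circ$-a.e. Let $T$ be a random vector in $[0,1)^d$ such that, under $\mathbf P^\circ$, the conditional distribution of $T$ given $(X^\circ,\xi^\circ)$ is uniform on $[0,1)^d$. Let $D^\circ$ be constructed from $\theta_{-T}\xi^\circ$ as in the context, and let $S$ be a random vector taking values in $D^\circ$ such that, under $\mathbf P^\circ$, the conditional distribution of $S$ given $((X^\circ,\xi^\circ),T)$ is uniform on $D^\circ$. Define $$(X,\xi):=\theta_S\theta_{-T}(X^\circ,\xi^\circ),\qquad d\mathbf P:=\frac{|D^\circ|}{\theta_{-T}\xi^\circ([0,1)^d)}\,d\mathbf P^\circ .$$ Then, under $\mathbf P$, $(X,\xi)$ is stationary and the conditional distribution of $T$ given $(X,\xi)$ is $(\theta_{-S}\xi)(\,\cdot\mid[0,1)^d)$. Moreover, $(X^\circ,\xi^\circ)$ under $\mathbf P^\circ$ is the Palm version of $(X,\xi)$ under $\mathbf P$.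
   Context: Setting. $(\Omega,\mathcal F)$ is a measurable space carrying the random elements (extended if further randomization is needed); $\mathbf P$ and $\mathbf P^\circ$ are measures on it, not necessarily probability measures, with integrals $\mathbf E$, $\mathbf E^\circ$. $\lambda$ is Lebesgue measure on $\mathbb R^d$. For a measure $\mu$ and a set $A$ with $0<\mu(A)<\infty$, $\mu(\cdot\mid A):=\mu(\cdot\cap A)/\mu(A)$. The symbol $\overset{D}{=}$ denotes equality of distributions (under the indicated measure). $(E,\mathcal E)$ is a measurable space on which the additive group $\mathbb R^d$ acts by maps $\theta_t$, $t\in\mathbb R^d$, such that $(t,x)\mapsto\theta_t x$ is measurable from $\mathbb R^d\times E$ to $E$. $X^\circ$ is a random element in $(E,\mathcal E)$ and $\xi^\circ$ is a random (locally finite) measure on $\mathbb R^d$ having $0$ in its support $\mathbf P^\circ$-a.e. For a measure, $\theta_t\xi(B):=\xi(B+t)$ for Borel $B\subseteq\mathbb R^d$, and $\theta_t(X,\xi):=(\theta_tX,\theta_t\xi)$. All distributions of $(X,\xi)$ and $(X^\circ,\xi^\circ)$ under $\mathbf P$ and $\mathbf P^\circ$ are understood to be $\sigma$-finite. Stationarity: $(X,\xi)$ is stationary under $\mathbf P$ if $\theta_t(X,\xi)\overset{D}{=}(X,\xi)$ under $\mathbf P$ for all $t\in\mathbb R^d$. Mass-stationarity: $(X^\circ,\xi^\circ)$ is mass-stationary under $\mathbf P^\circ$ if for all bounded Borel $C\subset\mathbb R^d$ with $\lambda(C)>0$ and $\lambda(\partial C)=0$, $$(\theta_{V_C}(X^\circ,\xi^\circ),V_C+U_C)\overset{D}{=}((X^\circ,\xi^\circ),U_C)\quad\text{under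 }\mathbf P^\circ,$$ where under $\mathbf P^\circ$ the conditional distribution of $U_C$ given $(X^\circ,\xi^\circ)$ is uniform on $C$ and the conditional distribution of $V_C$ given $((X^\circ,\xi^\circ),U_C)$ is $\xi^\circ(\cdot\mid C-U_C)$, with $C-x:=\{y-x:y\in C\}$. Palm version: $(X^\circ,\xi^\circ)$ under $\mathbf P^\circ$ is the Palm version of a stationary pair $(X,\xi)$ under $\mathbf P$ if for each nonnegative measurable $f$ and some (equivalently each) Borel $B\subset\mathbb R^d$ with $0<\lambda(B)<\infty$, $$\mathbf E^\circ[f(X^\circ,\xi^\circ)]=\mathbf E\Big[\int_B f(\theta_t(X,\xi))\,\xi(dt)\Big]\Big/\lambda(B).$$ Construction of $D^\circ$: let $N^\circ$ be the simple point process on $\mathbb Z^d$ with a point at $i\in\mathbb Z^d$ if and only if $\theta_{-T}\xi^\circ(i+[0,1)^d)>0$. (Since $0\in\operatorname{supp}\xi^\circ$ and $T\in(0,1)^d$ a.e., $N^\circ$ has a point at $0$ $\mathbf P^\circ$-a.e.) Partition $\mathbb Z^d$ into the Voronoi cells obtained by associating each $i\in\mathbb Z^d$ with the point of $N^\circ$ closest to $i$, choosing the lexicographically lowest one if there are several closest points; each cell contains exactly one point of $N^\circ$. $D^\circ$ is the cell containing $0$; under the convex hull assumption its number of elements $|D^\circ|$ is finite $\mathbf P^\circ$-a.e. *)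

(* Defs.v *)
From HB Require Import structures.
From mathcomp Require Import all_boot all_order all_algebra.
From mathcomp Require Import all_classical all_reals all_analysis.
From mathcomp Require Import measurable_realfun.
Import Order.TTheory GRing.Theory Num.Theory.
Import numFieldNormedType.Exports.

Set Implicit Arguments.
Unset Strict Implicit.
Unset Printing Implicit Defensive.

Local Open Scope classical_set_scope.
Local Open Scope ring_scope.

Definition borel_rV_display : measure_display. Proof. by constructor. Qed.

Section borel_rV.
Variables (R : realType) (n : nat).

Let borel_rV : set (set 'rV[R]_n) := <<s @open 'rV[R]_n >>.

Let borel_rV0 : borel_rV set0. Proof. exact: sigma_algebra0. Qed.

Let borel_rVC A : borel_rV A -> borel_rV (~` A).
Proof. exact: sigma_algebraC. Qed.

Let borel_rVU (F : (set 'rV[R]_n)^nat) :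
  (forall i, borel_rV (F i)) -> borel_rV (\bigcup_i F i).
Proof. exact: sigma_algebra_bigcup. Qed.

HB.instance Definition _ := @isMeasurable.Build borel_rV_display 'rV[R]_n
  borel_rV borel_rV0 borel_rVC borel_rVU.

End borel_rV.

Section borel_rV_lemmas.
Variables (R : realType) (n : nat).

Lemma open_measurable_rV (U : set 'rV[R]_n) : open U -> measurable U.
Proof. by move=> oU; apply: sub_sigma_algebra. Qed.

Lemma continuous_measurable_rV m (f : 'rV[R]_n -> 'rV[R]_m) :
  continuous f -> measurable_fun setT f.
Proof.
move=> cf; apply: (measurability (@open 'rV[R]_m)) => // _ [U oU <-].
by rewrite setTI; apply: open_measurable_rV; move/continuousP: cf; apply.
Qed.

Lemma measurable_coord (j : 'I_n) :
  measurable_fun setT (fun v : 'rV[R]_n => v ord0 j).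
Proof.
apply: (measurability _ (RGenOpens.measurableE R)) => _ [_ [x [y ->]] <-].
rewrite setTI; apply: open_measurable_rV.
have /continuousP := @coord_continuous R 1 n ord0 j; apply.
exact: interval_open.
Qed.

Let box (ab : 'rV[rat]_n * 'rV[rat]_n) : set 'rV[R]_n :=
  \bigcap_j ((fun v : 'rV[R]_n => v ord0 j) @^-1`
             `]ratr (ab.1 ord0 j), ratr (ab.2 ord0 j)[).

Let open_bigcup_box (U : set 'rV[R]_n) : open U ->
  U = \bigcup_ab (if `[< box ab `<=` U >] then box ab else set0).
Proof.
move=> oU; apply/seteqP; split => [v Uv|v [ab _]]; last first.
  by case: asboolP => // sU /sU.
have /nbhs_ballP[e /= e0 eU] : nbhs v U by exact: open_nbhs_nbhs.
have lo j : exists q : rat, v ord0 j - e < ratr q < v ord0 j.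
  have /rat_in_itvoo[q] : v ord0 j - e < v ord0 j by rewrite gtrBl.
  by rewrite in_itv; exists q.
have hi j : exists q : rat, v ord0 j < ratr q < v ord0 j + e.
  have /rat_in_itvoo[q] : v ord0 j < v ord0 j + e by rewrite ltrDl.
  by rewrite in_itv; exists q.
have [a aP] := choice lo; have [b bP] := choice hi.
exists (\row_j a j, \row_j b j) => //; case: asboolP => [_ j _|].
  rewrite /= in_itv /= !mxE.
  by have /andP[_ ->] := aP j; have /andP[-> _] := bP j.
case=> w boxw; apply: eU; split => // i j; rewrite (ord1 i).
have := boxw j I; rewrite /= in_itv /= !mxE /ball /= => /andP[aw wb].
have /andP[va av] := aP j; have /andP[vb bv] := bP j.
rewrite ltr_distl; apply/andP; split.
  by rewrite ltrBlDr (lt_trans wb).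
by rewrite -ltrBlDr (lt_trans va).
Qed.

Lemma measurable_fun_rV d (T : measurableType d) (f : T -> 'rV[R]_n) :
  (forall j, measurable_fun setT (fun x => f x ord0 j)) ->
  measurable_fun setT f.
Proof.
move=> mf; apply: (measurability (@open 'rV[R]_n)) => // _ [U oU <-].
rewrite setTI (open_bigcup_box oU) preimage_bigcup.
apply: countable_bigcupT_measurable => [|ab]; first exact: countableP.
case: asboolP => _; last by rewrite preimage_set0.
rewrite /box preimage_bigcap; apply: fin_bigcap_measurable => // j _.
rewrite -comp_preimage -[X in measurable X]setTI; apply: mf => //.
Qed.

End borel_rV_lemmas.

Section lebesgue_rV.
Variable R : realType.
Local Open Scope ereal_scope.

Lemma product_sigma_finite d1 d2 (T1 : measurableType d1) (T2 : measurableType d2)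
    (m1 : {sigma_finite_measure set T1 -> \bar R})
    (m2 : {sigma_finite_measure set T2 -> \bar R}) :
  sigma_finite setT (m1 \x m2).
Proof.
have /sigma_finiteP[F [TF ndF Foo]] := sigma_finiteT m1.
have /sigma_finiteP[G [TG ndG Goo]] := sigma_finiteT m2.
exists (fun n => F n `*` G n) => [|k].
  rewrite -setXTT TF TG predeqE => -[x y]; split=> [[/= [n _ Fnx] [k _ Gky]]|].
    exists (maxn n k) => //; split.
      by move: x Fnx; exact/subsetPset/ndF/leq_maxl.
    by move: y Gky; exact/subsetPset/ndG/leq_maxr.
  by case=> n _ [/= ? ?]; split; exists n.
have [? ?] := Foo k; have [? ?] := Goo k; split; first exact: measurableX.
by rewrite product_measure1E// lte_mul_pinfty// ge0_fin_numE.
Qed.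

Definition cons_rV n (p : R * 'rV[R]_n) : 'rV[R]_n.+1 :=
  \row_j (if unlift ord0 j is Some k then p.2 ord0 k else p.1).

Definition uncons_rV n (v : 'rV[R]_n.+1) : R * 'rV[R]_n :=
  (v ord0 ord0, \row_k v ord0 (lift ord0 k)).

Lemma cons_rVK n : cancel (@cons_rV n) (@uncons_rV n).
Proof.
case=> x v; rewrite /uncons_rV /cons_rV mxE unlift_none /=; congr pair.
by apply/rowP => k; rewrite !mxE liftK.
Qed.

Lemma measurable_cons_rV n : measurable_fun setT (@cons_rV n).
Proof.
apply: measurable_fun_rV => j.
under eq_fun do rewrite mxE.
case: (unlift ord0 j) => [k|]; last exact: measurable_fst.
exact: measurableT_comp (measurable_coord _) measurable_snd.
Qed.

Lemma measurable_uncons_rV n : measurable_fun setT (@uncons_rV n).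
Proof.
apply: measurable_fun_pair; first exact: measurable_coord.
apply: measurable_fun_rV => j.
under eq_fun do rewrite mxE.
exact: measurable_coord.
Qed.

Section lebesgue_rVS.
Variables (n : nat) (m : {sigma_finite_measure set 'rV[R]_n -> \bar R}).

Definition lebesgue_rVS : set 'rV[R]_n.+1 -> \bar R :=
  pushforward (@lebesgue_measure R \x m) (@cons_rV n).

Let mf := @measurable_cons_rV n.

Let lebesgue_rVS0 : lebesgue_rVS set0 = 0.
Proof. by rewrite /lebesgue_rVS /pushforward preimage_set0 measure0. Qed.

Let lebesgue_rVS_ge0 A : 0 <= lebesgue_rVS A.
Proof. exact: measure_ge0. Qed.

Let lebesgue_rVS_sigma_additive : semi_sigma_additive lebesgue_rVS.
Proof. by rewrite /lebesgue_rVS; exact: measure_semi_sigma_additive. Qed.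

HB.instance Definition _ := isMeasure.Build _ _ _ lebesgue_rVS
  lebesgue_rVS0 lebesgue_rVS_ge0 lebesgue_rVS_sigma_additive.

Let lebesgue_rVS_sigma_finite : sigma_finite setT lebesgue_rVS.
Proof.
have [F FT Foo] : sigma_finite setT (@lebesgue_measure R \x m).
  exact: product_sigma_finite.
exists (fun k => @uncons_rV n @^-1` F k) => [|k].
  by rewrite -preimage_bigcup -FT preimage_setT.
have [mF Fk] := Foo k; split.
  by rewrite -[X in measurable X]setTI; exact: measurable_uncons_rV.
rewrite /lebesgue_rVS /pushforward -comp_preimage.
rewrite (_ : _ \o _ = id)//; apply/funext => p; exact: cons_rVK.
Qed.

HB.instance Definition _ := @Measure_isSigmaFinite.Build _ _ _
  lebesgue_rVS lebesgue_rVS_sigma_finite.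

End lebesgue_rVS.

Fixpoint lebesgue_rV n : {sigma_finite_measure set 'rV[R]_n -> \bar R} :=
  match n return {sigma_finite_measure set 'rV[R]_n -> \bar R} with
  | 0%N => \d_(0%R : 'rV[R]_0)
  | n'.+1 => lebesgue_rVS (lebesgue_rV n')
  end.

Lemma lebesgue_rV_box n (A : 'I_n -> set R) : (forall j, measurable (A j)) ->
  lebesgue_rV n [set x | forall j, A j (x ord0 j)] =
  \prod_(j < n) lebesgue_measure (A j).
Proof.
elim: n A => [|n IH] A mA.
  by rewrite big_ord0 /= diracE mem_set// => -[].
rewrite big_ord_recl -IH//= /lebesgue_rVS /pushforward.
rewrite -product_measure1E//=; [|exact: mA|]; last first.
  rewrite [X in measurable X](_ : _ =
      \bigcap_j ((fun x : 'rV[R]_n => x ord0 j) @^-1` A (lift ord0 j))).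
    apply: fin_bigcap_measurable => // j _.
    by rewrite -[X in measurable X]setTI; exact: measurable_coord.
  by apply/seteqP; split=> x /= xA j; [move=> _|]; exact: xA.
congr (product_measure1 _ _ _); apply/seteqP; split=> -[x v] /=.
  move=> H; split=> [|j]; first by have := H ord0; rewrite mxE unlift_none.
  by have := H (lift ord0 j); rewrite mxE liftK.
by case=> Ax Av j; rewrite mxE; case: unliftP => [k ->|->].
Qed.

End lebesgue_rV.

Record lfmeasure (R : realType) (n : nat) := LFMeasure {
  lfmeasure_val :> {measure set 'rV[R]_n -> \bar R} ;
  lfmeasure_fin : forall B : set 'rV[R]_n,
    measurable B -> bounded_set B -> (lfmeasure_val B < +oo)%E
}.

Definition lfmeasure_display : measure_display. Proof. by constructor. Qed.

Section lfmeasure_measurable.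
Variables (R : realType) (n : nat).
Notation M := (lfmeasure R n).

HB.instance Definition _ := gen_eqMixin M.
HB.instance Definition _ := gen_choiceMixin M.

Let mzero_fin (B : set 'rV[R]_n) : measurable B -> bounded_set B ->
  ((mzero : {measure set 'rV[R]_n -> \bar R}) B < +oo)%E.
Proof. by move=> _ _; rewrite /mzero ltry. Qed.

HB.instance Definition _ := isPointed.Build M (LFMeasure mzero_fin).

(* The sigma-algebra generated by the evaluation maps xi |-> xi B, B Borel. *)
Definition lfmeasure_measurable : set (set M) :=
  <<s \bigcup_(B in @measurable _ 'rV[R]_n)
        preimage_set_system [set: M] (fun xi : M => xi B) measurable >>.

Let lfmeasure_measurable0 : lfmeasure_measurable set0.
Proof. exact: sigma_algebra0. Qed.

Let lfmeasure_measurableC A :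
  lfmeasure_measurable A -> lfmeasure_measurable (~` A).
Proof. exact: sigma_algebraC. Qed.

Let lfmeasure_measurableU (F : (set M)^nat) :
  (forall i, lfmeasure_measurable (F i)) ->
  lfmeasure_measurable (\bigcup_i F i).
Proof. exact: sigma_algebra_bigcup. Qed.

HB.instance Definition _ := @isMeasurable.Build lfmeasure_display M
  lfmeasure_measurable lfmeasure_measurable0 lfmeasure_measurableC
  lfmeasure_measurableU.

End lfmeasure_measurable.

Section shift.
Variables (R : realType) (n : nat) (t : 'rV[R]_n) (xi : lfmeasure R n).

Lemma measurable_subr : measurable_fun setT (fun x : 'rV[R]_n => x - t).
Proof.
apply: continuous_measurable_rV => x.
apply: (@continuousB R 'rV[R]_n 'rV[R]_n idfun (cst t)) => //.
exact: cst_continuous.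
Qed.

Definition shift_fun : set 'rV[R]_n -> \bar R := pushforward xi (fun x => x - t).

Let mf := measurable_subr.

Let shift_fun0 : (shift_fun set0 = 0)%E.
Proof. by rewrite /shift_fun /pushforward preimage_set0 measure0. Qed.

Let shift_fun_ge0 A : (0 <= shift_fun A)%E.
Proof. exact: measure_ge0. Qed.

Let shift_fun_sigma_additive : semi_sigma_additive shift_fun.
Proof. by rewrite /shift_fun; exact: measure_semi_sigma_additive. Qed.

HB.instance Definition _ := isMeasure.Build _ _ _ shift_fun
  shift_fun0 shift_fun_ge0 shift_fun_sigma_additive.

Lemma shift_funE B : shift_fun B = xi [set b + t | b in B].
Proof.
rewrite /shift_fun /pushforward; congr (xi _); apply/seteqP; split => x /=.
  by move=> Bx; exists (x - t) => //; rewrite subrK.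
by case=> b Bb <-; rewrite addrK.
Qed.

Let shift_fin (B : set 'rV[R]_n) :
  measurable B -> bounded_set B -> (shift_fun B < +oo)%E.
Proof.
move=> mB bB; apply: lfmeasure_fin.
  by rewrite -[X in measurable X]setTI; exact: measurable_subr.
case: bB => M [_ MB]; exists (M + 1 + `|t|); split; first exact: num_real.
move=> N MN x /= Bx; rewrite -(subrK t x).
apply: (le_trans (ler_normD _ _)); rewrite -lerBrDr; apply: MB => //.
by rewrite ltrBrDr (lt_trans _ MN)// ltrD2r ltrDl.
Qed.

(* B |-> xi (B + t), by shift_funE. *)
Definition shift_measure : lfmeasure R n := LFMeasure shift_fin.

End shift.

Section definitions.
Variables (R : realType) (d : nat).
Notation Rd := 'rV[R]_d.
Notation M := (lfmeasure R d).
Notation lambda := (@lebesgue_rV R d).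
Local Open Scope ereal_scope.

(* mu( . | A) when 0 < mu A < +oo; otherwise 0, as 0 * +oo = 0 in \bar R. *)
Definition cond_measure (T : Type) (mu : set T -> \bar R) (A B : set T) :=
  mu (B `&` A) / mu A.

Definition msupport (mu : set Rd -> \bar R) : set Rd :=
  [set x | forall U, open U -> U x -> 0 < mu U].

Definition convex_hull (A : set Rd) : set Rd :=
  smallest (fun C => convex_set (C : set (convex_lmodType Rd))) A.

Definition boundary (A : set Rd) : set Rd := closure A `\` A°.

Definition unit_cube : set Rd :=
  [set x | forall j, (0 <= x ord0 j < 1)%R].

Definition eq_dist dO dO' dT (O : measurableType dO) (O' : measurableType dO')
    (T : measurableType dT) (P : {measure set O -> \bar R}) (Y : O -> T)
    (P' : {measure set O' -> \bar R}) (Y' : O' -> T) : Prop :=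
  forall A, measurable A -> P (Y @^-1` A) = P' (Y' @^-1` A).

(* Under P, the conditional distribution of U given Y is K.  The kernel is
   written as a function of the sample point: for every B, K _ B must be a.e. a
   measurable function of Y and integrate over the events {Y in A} to
   P(Y in A, U in B). *)
Definition cond_distribution dO dT dV (O : measurableType dO)
    (T : measurableType dT) (V : measurableType dV)
    (P : {measure set O -> \bar R}) (Y : O -> T) (U : O -> V)
    (K : O -> set V -> \bar R) : Prop :=
  forall B : set V, measurable B ->
    (exists k : T -> \bar R,
       measurable_fun setT k /\ {ae P, forall w, K w B = k (Y w)}) /\
    (forall A, measurable A ->
       P (Y @^-1` A `&` U @^-1` B) = \int[P]_(w in Y @^-1` A) K w B).

Section pair.
Context dE (E : measurableType dE) (theta : Rd -> E -> E).
Context dO (Omega : measurableType dO).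
Implicit Types (P : {measure set Omega -> \bar R}).
Implicit Types (X : Omega -> E) (xi : Omega -> M).

Definition shift_pair (t : Rd) (y : E * M) : E * M :=
  (theta t y.1, shift_measure t y.2).

Definition stationary P X xi : Prop :=
  forall t, eq_dist P (fun w => shift_pair t (X w, xi w))
                    P (fun w => (X w, xi w)).

(* (Omega', P') is an extension of (Omega, P) carrying U and V; the joint
   distribution of ((X, xi), U_C, V_C) is determined by the two conditional
   distributions, hence does not depend on the extension. *)
Definition mass_stationary P X xi : Prop :=
  forall C : set Rd, measurable C -> bounded_set C ->
    0 < lambda C -> lambda (boundary C) = 0 ->
  exists (dO' : measure_display) (Omega' : measurableType dO')
    (P' : {measure set Omega' -> \bar R}) (pi : Omega' -> Omega)
    (U V : Omega' -> Rd),
  let Y w := (X (pi w), xi (pi w)) in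
  [/\ measurable_fun setT pi,
      forall A, measurable A -> P' (pi @^-1` A) = P A,
      measurable_fun setT U /\ measurable_fun setT V,
      cond_distribution P' Y U (fun _ => cond_measure lambda C) /\
      cond_distribution P' (fun w => (Y w, U w)) V
        (fun w => cond_measure (xi (pi w)) [set (y - U w)%R | y in C]) &
      eq_dist P' (fun w => (shift_pair (V w) (Y w), (V w + U w)%R))
              P' (fun w => (Y w, U w))].

End pair.

Definition palm_version dE (E : measurableType dE) (theta : Rd -> E -> E)
    dO (Omega : measurableType dO)
    (P0 : {measure set Omega -> \bar R}) (X0 : Omega -> E) (xi0 : Omega -> M)
    (P : {measure set Omega -> \bar R}) (X : Omega -> E) (xi : Omega -> M) :=
  forall f : E * M -> \bar R,
    measurable_fun setT f -> (forall y, 0 <= f y) ->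
  forall B : set Rd, measurable B -> 0 < lambda B -> lambda B < +oo ->
  \int[P0]_w f (X0 w, xi0 w) =
    (\int[P]_w \int[xi w]_(t in B) f (shift_pair theta t (X w, xi w)))
      / lambda B.

Notation Zd := 'rV[int]_d.

Definition lattice (i : Zd) : Rd := map_mx intr i.

Definition lattice_dist (i j : Zd) : R :=
  Num.sqrt (\sum_k ((i ord0 k - j ord0 k)%:~R ^+ 2)%R)%R.

Definition lex_lt (i j : Zd) : Prop :=
  exists k : 'I_d, (forall l : 'I_d, (l < k)%N -> i ord0 l = j ord0 l) /\
                   (i ord0 k < j ord0 k)%R.

Definition voronoi_center (N : set Zd) (i j : Zd) : Prop :=
  [/\ N j,
      forall k, N k -> (lattice_dist i j <= lattice_dist i k)%R &
      forall k, N k -> lattice_dist i k = lattice_dist i j ->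
        k = j \/ lex_lt j k].

Definition voronoi_cell0 (N : set Zd) : set Zd :=
  [set i | exists j, voronoi_center N 0%R j /\ voronoi_center N i j].

Definition cube_process (mu : set Rd -> \bar R) : set Zd :=
  [set i | 0 < mu [set (lattice i + x)%R | x in unit_cube]].

(* The cell of 0 is kept as a subset of R^d; lattice being injective, counting
   gives its number of elements. *)
Definition zero_cell (mu : set Rd -> \bar R) : set Rd :=
  lattice @` voronoi_cell0 (cube_process mu).

End definitions.

Arguments unit_cube {R d}.

(* Main.v *)
(** Write Y for the pair under P0, z_t for Y shifted by -t and zeta_t for its
    measure component.  Mass-stationarity on the cubes C_n says that, under
    P0(dY) dt restricted to t in C_n, the conditional distribution of t given z_t
    is zeta_t( . | C_n).  Resampling t and letting n tend to infinity makes the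
    measure P0(dY) dt zeta_t(ds) of (z_t, t, s) symmetric in t and s.

    Let c be the centre of the Voronoi cell of 0 and kappa(z, . ) the density of
    zeta( . | c + [0,1)^d) with respect to zeta, the measure component of z.  Since
    s lies in the cell of 0 exactly when - s is the centre of 0 after a shift by s,
    summing over the values of S and translating t gives, with Z := (X, xi),
      E F(Z, T) = E0 \int kappa(z_t, t) F(z_t, t - c) dt.
    As kappa(z, . ) integrates to 1 against zeta, the symmetry turns this into
      E \int g(Z, s) xi(ds) = E0 \int g(z_t, t) dt,
    which is the Palm property; taking for g the indicator of {Z shifted by a in A}
    times kappa shifted by a, and translating t, shows that P(Z shifted by a in A)
    does not depend on a.  The conditional distribution of T follows from the same
    symmetry with a factor kappa in both t and s. *)

(* Mass-stationarity acts on times only: moving [(Y, U)] to [(Y shifted by V, V + U)] leaves [z],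
   the shift of [Y] by [- U], unchanged. Given [(Y, U)], the new time [V + U] has the law
   [zeta( . | C)], because the mass of [C - U] under [xi0] is [zeta(C)]. The normalizing factor
   depends on [z] alone and so survives the exchange of t and s. The two factors of the density of P
   have separate origins. The size of the cell cancels the weight of the uniform choice of S, so
   that each lattice point of the cell counts once. The mass of the unit cube becomes, in terms of
   the shifted measure, the mass of [c + [0,1)^d], which normalizes kappa. Neither P0 nor P need be
   finite, so nothing is ever subtracted: all identities concern functions with values in
   [[0, +oo]]. The definitions speak of events; sigma-finiteness of the law of Y is what upgrades
   them to identities of integrals. *)
Require Import Defs.
From HB Require Import structures.
From mathcomp Require Import all_boot all_order all_algebra.
From mathcomp Require Import finmap.
From mathcomp Require Import all_classical all_reals all_analysis.
From mathcomp Require Import measurable_realfun.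
Import Order.TTheory GRing.Theory Num.Theory.
Import numFieldNormedType.Exports.

Set Implicit Arguments.
Unset Strict Implicit.
Unset Printing Implicit Defensive.

Local Open Scope classical_set_scope.
Local Open Scope ring_scope.
Local Open Scope ereal_scope.

(** * Integration and disintegration of nonnegative functions *)

Section integration.
Context {R : realType}.

Import HBNNSimple.

(** The standard machine as an induction principle: an integral identity needs checking on
    indicators only. The premises carry measurability and nonnegativity because linearity of the
    integral requires them. *)
Lemma ge0_measurable_ind d (T : measurableType d) (C : (T -> \bar R) -> Prop) :
  (forall A, measurable A -> C (fun x => (\1_A x)%:E)) ->
  (forall (r : R) f, (0 <= r)%R -> measurable_fun setT f ->
    (forall x, 0 <= f x) -> C f -> C (fun x => r%:E * f x)) ->
  (forall f g, measurable_fun setT f -> (forall x, 0 <= f x) ->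
    measurable_fun setT g -> (forall x, 0 <= g x) ->
    C f -> C g -> C (fun x => f x + g x)) ->
  (forall f : nat -> T -> \bar R, (forall n, measurable_fun setT (f n)) ->
    (forall n x, 0 <= f n x) -> (forall x, nondecreasing_seq (f ^~ x)) ->
    (forall n, C (f n)) -> C (fun x => limn (f ^~ x))) ->
  forall f, measurable_fun setT f -> (forall x, 0 <= f x) -> C f.
Proof.
move=> C1 CZ CD Clim f mf f0.
pose f_ := nnsfun_approx measurableT mf.
have -> : f = (fun x => limn (fun n => (f_ n x)%:E)).
  by apply/funext => x; apply/esym/cvg_lim => //; exact: cvg_nnsfun_approx.
apply: Clim => [n|n x|x m n mn|n].
- exact/measurable_EFinP.
- by rewrite lee_fin.
- by rewrite lee_fin; exact/lefP/nd_nnsfun_approx.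
pose g := f_ n.
have Cr r : r \in range g -> C (fun x => r%:E * (\1_(g @^-1` [set r]) x)%:E).
  rewrite inE => -[y _ <-]; apply: (CZ (g y)) => //; last exact: C1.
  exact/measurable_EFinP.
have C0 : C (fun=> 0).
  rewrite (_ : (fun=> 0) = (fun x => (\1_set0 x)%:E)); first exact: C1.
  by apply/funext => x; rewrite indic0.
rewrite (_ : (fun x => _) = (fun x => \sum_(r <- fset_set (range g))
    (r%:E * (\1_(g @^-1` [set r]) x)%:E))); last first.
  apply/funext => x; rewrite -[LHS]/((g x)%:E) fimfunE -fsumEFin//.
  by rewrite fsbig_finite//=; apply: eq_bigr => r _; rewrite EFinM.
have : forall r, r \in (fset_set (range g) : seq R) -> r \in range g.
  by move=> r; rewrite in_fset_set.
move: (fset_set _ : seq R) => s.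
(* Premise [CD] asks for a nonnegative tail, so the induction also records that the values in [s]
   are nonnegative. *)
suff H : (forall r, r \in s -> r \in range g) -> C (fun x => \sum_(r <- s)
    (r%:E * (\1_(g @^-1` [set r]) x)%:E)) /\ forall r, r \in s -> (0 <= r)%R.
  by move=> hs; have [] := H hs.
elim: s => [_|r s IH rs].
  by split => //; under eq_fun do rewrite big_nil.
have rg : r \in range g by apply: rs; rewrite mem_head.
have r0 : (0 <= r)%R by move: rg; rewrite inE => -[y _ <-].
have [Cs s0] := IH (fun t ts => rs t (mem_behead (s := r :: s) ts)).
split; last by move=> t; rewrite in_cons => /predU1P[->//|]; exact: s0.
under eq_fun do rewrite big_cons.
apply: CD => //.
- by apply: measurable_funeM; exact/measurable_EFinP.
- by move=> x; rewrite mule_ge0// lee_fin.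
- by apply: emeasurable_sum => t; apply: measurable_funeM; exact/measurable_EFinP.
- by move=> x; rewrite big_seq sume_ge0// => t ts; rewrite mule_ge0// lee_fin// s0.
- exact: Cr.
Qed.

(** Multiplication by [+oo] is not continuous at 0. For [x = +oo], either [u] vanishes identically
    or some term is positive, and then both sides are [+oo]. *)
Lemma ge0_nd_limeMl (x : \bar R) (u : (\bar R)^nat) : 0 <= x ->
  (forall n, 0 <= u n) -> nondecreasing_seq u ->
  limn (fun n => x * u n) = x * limn u.
Proof.
move=> x0 u0 ndu; have cu := ereal_nondecreasing_is_cvgn ndu.
case: x x0 => [r r0|_|//]; first by rewrite limeMl.
have ndv : nondecreasing_seq (fun n => +oo * u n).
  by move=> m n mn; rewrite lee_wpmul2l// ndu.
have le_u n : u n <= limn u.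
  rewrite (cvg_lim _ (ereal_nondecreasing_cvgn ndu))//.
  by apply: ereal_sup_ubound; exists n.
have le_v n : +oo * u n <= limn (fun n => +oo * u n).
  rewrite (cvg_lim _ (ereal_nondecreasing_cvgn ndv))//.
  by apply: ereal_sup_ubound; exists n.
have [u_eq0|/existsNP[n /eqP un0]] := pselect (forall n, u n = 0).
  rewrite (_ : u = fun=> 0); last exact/funext.
  by under eq_fun do rewrite mule0; rewrite lim_cst// mule0.
have un : 0 < u n by rewrite lt0e un0; exact: u0.
rewrite [RHS]gt0_mulye ?(lt_le_trans un)//; apply/eqP.
by rewrite -leye_eq (le_trans _ (le_v n))// gt0_mulye.
Qed.

(** Covers densities, with [W := id], and images of weighted measures, as in
    [integral_S_uniform]. *)
Lemma integral_density dO dT (O : measurableType dO) (T : measurableType dT)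
    (mu : {measure set O -> \bar R}) (nu : {measure set T -> \bar R})
    (W : O -> T) (g : O -> \bar R) :
  measurable_fun setT W -> measurable_fun setT g -> (forall x, 0 <= g x) ->
  (forall A, measurable A -> nu A = \int[mu]_(x in W @^-1` A) g x) ->
  forall f, measurable_fun setT f -> (forall x, 0 <= f x) ->
  \int[nu]_x f x = \int[mu]_x (g x * f (W x)).
Proof.
move=> mW mg g0 nuE; apply: ge0_measurable_ind.
- move=> A mA; rewrite integral_indic// setIT nuE// integral_mkcond.
  apply: eq_integral => x _; rewrite patchE indicE.
  rewrite (_ : (x \in W @^-1` A) = (W x \in A)); last first.
    by apply/idP/idP; rewrite !inE.
  by case: ifPn; rewrite ?mule1 ?mule0.
- move=> r f r0 mf f0 IH.
  rewrite ge0_integralZl// IH.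
  have mfW := measurableT_comp mf mW.
  rewrite -ge0_integralZl//; last 2 first.
  + exact: emeasurable_funM.
  + by move=> x _; rewrite mule_ge0.
  + by apply: eq_integral => x _; rewrite muleCA.
- move=> f h mf f0 mh h0 IHf IHh.
  have mfW := measurableT_comp mf mW; have mhW := measurableT_comp mh mW.
  rewrite ge0_integralD// IHf IHh -ge0_integralD//.
  + by apply: eq_integral => x _; rewrite ge0_muleDr.
  + by move=> x _; rewrite mule_ge0.
  + exact: emeasurable_funM.
  + by move=> x _; rewrite mule_ge0.
  + exact: emeasurable_funM.
- move=> f mf f0 ndf IH.
  rewrite monotone_convergence//.
  under eq_fun do rewrite IH.
  rewrite -monotone_convergence//.
  + apply: eq_integral => x _; rewrite ge0_nd_limeMl//; exact: ndf.
  + by move=> n; apply: emeasurable_funM => //; exact: measurableT_comp.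
  + by move=> n x _; rewrite mule_ge0.
  + by move=> x _ m n mn; rewrite lee_wpmul2l// ndf.
Qed.


Definition image_measure d d' (T : measurableType d) (T' : measurableType d')
    (m : {measure set T -> \bar R}) (f : T -> T')
    (mf : measurable_fun setT f) : {measure set T' -> \bar R} :=
  measure_function_pushforward__canonical__measure_function_Measure m mf.

Lemma integral_image_measure d d' (T : measurableType d)
    (T' : measurableType d') (m : {measure set T -> \bar R}) (f : T -> T')
    (mf : measurable_fun setT f) (g : T' -> \bar R) :
  measurable_fun setT g -> (forall y, 0 <= g y) ->
  \int[image_measure m mf]_y g y = \int[m]_x g (f x).
Proof. by move=> mg g0; rewrite ge0_integral_pushforward. Qed.

Section disintegration.
Context dO dT dV (O : measurableType dO) (T : measurableType dT)
  (V : measurableType dV).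
Variables (P : {measure set O -> \bar R}) (W : O -> T) (k : R.-fker T ~> V).
Hypothesis mW : measurable_fun setT W.

(** The law of [(W, V)] when V has conditional law [k] given W. The argument [mW'] hands the
    measurability proof to the measure instance. *)
Definition joint_measure_set (mW' : measurable_fun setT W) (A : set (T * V)) :=
  \int[P]_w k (W w) (xsection A (W w)).

Let m := joint_measure_set mW.

Let mxsec A : measurable A ->
  measurable_fun setT (fun w => k (W w) (xsection A (W w))).
Proof.
move=> mA; have mk : measurable_fun setT (fun t => k t (xsection A t)).
  by apply: measurable_fun_xsection_finite_kernel; rewrite inE.
exact: (measurableT_comp mk mW).
Qed.

Let m0 : m set0 = 0.
Proof.
by apply: integral0_eq => w _; rewrite xsection0 measure0.
Qed.

Let m_ge0 A : 0 <= m A.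
Proof. exact: integral_ge0. Qed.

Let m_sigma_additive : semi_sigma_additive m.
Proof.
move=> F mF tF mUF; rewrite /m /joint_measure_set.
have mS n : measurable_fun setT (fun w => k (W w) (xsection (F n) (W w))).
  exact: mxsec.
rewrite (_ : (fun n => _) = (fun n =>
    \int[P]_w \sum_(0 <= i < n) k (W w) (xsection (F i) (W w)))); last first.
  by apply/funext => n; rewrite ge0_integral_sum.
rewrite (_ : \int[P]_w _ = \int[P]_w
    limn (fun n => \sum_(0 <= i < n) k (W w) (xsection (F i) (W w)))).
  apply: cvg_monotone_convergence => //.
  - by move=> n; exact: emeasurable_sum.
  - by move=> n w _; exact: sume_ge0.
  - by move=> w _ a b ab; exact: lee_sum_nneg_natr.
apply: eq_integral => w _; apply/esym/cvg_lim => //.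
rewrite xsection_bigcup; apply: measure_semi_sigma_additive.
- by move=> n; exact: measurable_xsection.
- exact: trivIset_xsection.
- rewrite -xsection_bigcup; exact: measurable_xsection.
Qed.

HB.instance Definition _ := isMeasure.Build _ _ _ (joint_measure_set mW)
  m0 m_ge0 m_sigma_additive.

Definition joint_measure : {measure set (T * V) -> \bar R} :=
  joint_measure_set mW.

Lemma integral_joint_measure f : measurable_fun setT f -> (forall x, 0 <= f x) ->
  \int[joint_measure]_x f x = \int[P]_w \int[k (W w)]_v f (W w, v).
Proof.
have mk (g : T * V -> \bar R) : measurable_fun setT g -> (forall x, 0 <= g x) ->
    measurable_fun setT (fun w => \int[k (W w)]_v g (W w, v)).
  move=> mg g0.
  exact: (measurableT_comp (measurable_fun_integral_finite_kernel g k g0 mg) mW).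
have msec (g : T * V -> \bar R) t : measurable_fun setT g ->
    measurable_fun setT (fun v => g (t, v)).
  by move=> mg; exact: measurableT_comp.
move: f; apply: (ge0_measurable_ind (C := fun f => \int[joint_measure]_x f x =
    \int[P]_w \int[k (W w)]_v f (W w, v))).
- move=> A mA; rewrite integral_indic// setIT; apply: eq_integral => w _.
  rewrite -[X in k _ X]setIT -integral_indic//; last exact: measurable_xsection.
  by apply: eq_integral => v _; rewrite !indicE mem_xsection.
- move=> r f r0 mf f0 IH; rewrite ge0_integralZl// IH -ge0_integralZl//.
  + apply: eq_integral => w _; rewrite ge0_integralZl//; exact: msec.
  + exact: mk.
  + by move=> w _; exact: integral_ge0.
- move=> f g mf f0 mg g0 IHf IHg; rewrite ge0_integralD// IHf IHg.
  rewrite -ge0_integralD//; [|by move=> w _; exact: integral_ge0|exact: mk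
    |by move=> w _; exact: integral_ge0|exact: mk].
  by apply: eq_integral => w _; rewrite ge0_integralD//; exact: msec.
- move=> f mf f0 ndf IH; rewrite monotone_convergence//.
  under eq_fun do rewrite IH.
  rewrite -monotone_convergence//; last 3 first.
  + by move=> n; exact: mk.
  + by move=> n w _; exact: integral_ge0.
  + move=> w _ a b ab; apply: ge0_le_integral => //; try exact: msec.
    by move=> v _; exact: ndf.
  apply: eq_integral => w _; rewrite -monotone_convergence//.
  by move=> n; exact: msec.
Qed.

End disintegration.

(** [cond_distribution] fixes the joint law on rectangles only. These form a pi-system, and
    sigma-finiteness of the law of W gives an exhausting sequence of rectangles of finite mass, so
    the whole joint law is determined. *)
Lemma cond_distribution_integral dO dT dV (O : measurableType dO)
    (T : measurableType dT) (V : measurableType dV)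
    (P : {measure set O -> \bar R}) (W : O -> T) (U : O -> V)
    (k : R.-fker T ~> V) (K : O -> set V -> \bar R) :
  measurable_fun setT W -> measurable_fun setT U ->
  sigma_finite setT (pushforward P W) ->
  (forall w B, measurable B -> K w B = k (W w) B) ->
  cond_distribution P W U K ->
  forall f : T * V -> \bar R, measurable_fun setT f -> (forall x, 0 <= f x) ->
  \int[P]_w f (W w, U w) = \int[P]_w \int[k (W w)]_v f (W w, v).
Proof.
move=> mW mU [F FT Foo] KE cond f mf f0.
have mWU : measurable_fun setT (fun w => (W w, U w)).
  exact: measurable_fun_pair.
rewrite -(integral_joint_measure P k mW)// -(integral_image_measure _ mWU)//.
apply: eq_measure_integral => A mA _.
pose C : set (set (T * V)) :=
  [set B `*` B' | B in measurable & B' in measurable].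
apply: (@measure_unique _ R (T * V)%type C (fun n => F n `*` setT)) => //.
- by rewrite measurable_prod_measurableType.
- move=> _ _ [A1 mA1 [B1 mB1 <-]] [A2 mA2 [B2 mB2 <-]].
  rewrite -setXI; exists (A1 `&` A2); first exact: measurableI.
  by exists (B1 `&` B2) => //; exact: measurableI.
- by move=> n; exists (F n); [exact: (Foo n).1|exists setT].
- by rewrite -setX_bigcupl -FT setXTT.
- move=> _ [A1 mA1 [B1 mB1 <-]].
  rewrite /image_measure /joint_measure/= /pushforward /joint_measure_set.
  rewrite (_ : _ @^-1` _ = W @^-1` A1 `&` U @^-1` B1)//.
  rewrite (cond _ mB1).2// integral_mkcond; apply: eq_integral => w _.
  rewrite patchE; case: ifPn => [/set_mem WA|WA].
    by rewrite in_xsectionX ?KE//; exact: mem_set.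
  by rewrite notin_xsectionX ?measure0.
- move=> n; rewrite /image_measure/= /pushforward.
  rewrite (_ : _ @^-1` _ = W @^-1` F n); first exact: (Foo n).2.
  by apply/seteqP; split => [w [? ?]|w ?].
Qed.

End integration.

(** * Conditioning a measure on a set *)

Section conditioning.
Context {R : realType}.

Lemma measurable_invr : measurable_fun [set: R] (@GRing.inv R).
Proof.
have -> : @GRing.inv R = fun r => if r == 0%R then 0%R else r^-1%R.
  by apply/funext => r; case: eqP => // ->; rewrite invr0.
apply: measurable_fun_if => //=.
- apply: (measurable_fun_bool true).
  rewrite setTI (_ : _ @^-1` _ = [set 0%R])//.
  by apply/seteqP; split => [r /eqP //|r /= ->]; rewrite eqxx.
- rewrite setTI (_ : _ @^-1` _ = [set r : R | r != 0%R]); last first.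
    by apply/seteqP; split => r /= => [/negbT|/negbTE].
  apply: open_continuous_measurable_fun => //; apply/in_setP => r /= r0.
  exact: inv_continuous.
Qed.

Lemma measurable_inve : measurable_fun [set: \bar R] inve.
Proof.
have -> : @inve R = fun x => if x == 0 then +oo else if x == -oo then -oo
    else ((fine x)^-1)%:E.
  apply/funext => x; case: (inveP x) => //=; rewrite ?eqxx//= ?invr0//.
  by move=> r r0; rewrite eqe (negbTE r0).
apply: measurable_fun_ifT => //.
  exact: measurable_fun_eqe.
apply: measurable_fun_ifT => //.
  exact: measurable_fun_eqe.
by apply/measurable_EFinP; apply: measurableT_comp => //; exact: measurable_invr.
Qed.

Lemma measurable_funV d (T : measurableType d) (f : T -> \bar R) :
  measurable_fun setT f -> measurable_fun setT (fun x => (f x)^-1).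
Proof. exact: measurableT_comp measurable_inve. Qed.

Section cond.
Context d (T : measurableType d).
Variables (mu : {measure set T -> \bar R}) (A : set T) (mA : measurable A).

Let fineV_ge0 : (0 <= fine (mu A)^-1)%R.
Proof. by rewrite fine_ge0// inve_ge0. Qed.

(** [mscale] takes a finite factor. For [mu A = 0] the inverse is [+oo] and [fine] sends it to 0;
    this agrees with [cond_measure], whose numerator vanishes there. *)
Definition conditioned : {measure set T -> \bar R} :=
  mscale (NngNum fineV_ge0) (mrestr mu mA).

Let conditioned_def B : conditioned B = (fine (mu A)^-1)%:E * mu (B `&` A).
Proof. by []. Qed.

Lemma conditionedE B : measurable B -> conditioned B = cond_measure mu A B.
Proof.
move=> mB; rewrite conditioned_def /cond_measure [RHS]muleC.
have leBA : mu (B `&` A) <= mu A.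
  by apply: le_measure; rewrite ?inE//; exact: measurableI.
have muA0 : 0 <= mu A by [].
case: (inveP (mu A)) leBA muA0 => //=; rewrite ?mul0e//.
move=> BA0 _; suff -> : mu (B `&` A) = 0 by rewrite mule0.
by apply/eqP; rewrite eq_le BA0/=.
Qed.

(** An inequality because the mass is 0 when [mu A] is 0 or [+oo]. The uniform bound makes
    conditioning a finite kernel even for unbounded families of measures. *)
Lemma conditioned_le1 : conditioned setT <= 1.
Proof.
rewrite conditioned_def setTI.
have muA0 : 0 <= mu A by [].
case: (inveP (mu A)) muA0 => //=; rewrite ?mul0e//.
by move=> r r0 _; rewrite -EFinM mulVf.
Qed.

Lemma integral_mrestr (f : T -> \bar R) :
  measurable_fun setT f -> (forall x, 0 <= f x) ->
  \int[mrestr mu mA]_x f x = \int[mu]_(x in A) f x.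
Proof.
move=> mf f0; pose g : T -> \bar R := fun x => (\1_A x)%:E.
have mg : measurable_fun setT g by exact/measurable_EFinP.
rewrite (integral_density (mu := mu) (W := id) (g := g)) => //.
- rewrite [RHS]integral_mkcond; apply: eq_integral => x _.
  by rewrite /g patchE indicE; case: ifPn; rewrite ?mul1e ?mul0e.
- by move=> x; rewrite lee_fin.
- by move=> B mB; rewrite preimage_id integral_indic// setIC.
Qed.

Lemma integral_conditioned (f : T -> \bar R) :
  measurable_fun setT f -> (forall x, 0 <= f x) ->
  \int[conditioned]_x f x = (mu A)^-1 * \int[mu]_(x in A) f x.
Proof.
move=> mf f0; rewrite ge0_integral_mscale// integral_mrestr//.
rewrite -[LHS]/((fine (mu A)^-1)%:E * _).
have : mu A = 0 -> \int[mu]_(x in A) f x = 0.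
  by apply: null_set_integral => //; exact: measurable_funTS.
have muA0 : 0 <= mu A by [].
by case: (inveP (mu A)) muA0 => //= _ ->//; rewrite !mule0.
Qed.

End cond.

Section conditioning_kernel.
Context dX dY (X : measurableType dX) (Y : measurableType dY).
Variables (z : X -> {measure set Y -> \bar R}) (A : X -> set Y).
Hypothesis mA : forall x, measurable (A x).
Hypothesis mzA : forall B, measurable B ->
  measurable_fun setT (fun x => z x (B `&` A x)).

(* The phantom argument mzA' carries the measurability proof to the kernel
   instances outside the section. *)
Definition conditioning_kernel_fun
    (mzA' : forall B, measurable B ->
      measurable_fun setT (fun x => z x (B `&` A x))) x :
  {measure set Y -> \bar R} := conditioned (z x) (mA x).

Let k := conditioning_kernel_fun mzA.

Let mk B : measurable B -> measurable_fun setT (k ^~ B).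
Proof.
move=> mB; rewrite /k /conditioning_kernel_fun.
under eq_fun do rewrite conditionedE//.
apply: emeasurable_funM; first exact: mzA.
apply: measurable_funV.
by under eq_fun do rewrite -[A _]setTI; exact: mzA.
Qed.

HB.instance Definition _ := isKernel.Build _ _ _ _ _
  (conditioning_kernel_fun mzA) mk.

Let k_uub : measure_fam_uub k.
Proof.
by exists 2%R => x; rewrite (le_lt_trans (conditioned_le1 _ _))// lte_fin ltr1n.
Qed.

HB.instance Definition _ := Kernel_isFinite.Build _ _ _ _ _
  (conditioning_kernel_fun mzA) k_uub.

Definition conditioning_kernel : R.-fker X ~> Y := conditioning_kernel_fun mzA.

Lemma conditioning_kernelE x B : measurable B ->
  conditioning_kernel x B = cond_measure (z x) (A x) B.
Proof. exact: conditionedE. Qed.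

Lemma integral_conditioning_kernel x (f : Y -> \bar R) :
  measurable_fun setT f -> (forall y, 0 <= f y) ->
  \int[conditioning_kernel x]_y f y = (z x (A x))^-1 * \int[z x]_(y in A x) f y.
Proof. exact: integral_conditioned. Qed.

End conditioning_kernel.

End conditioning.

(** * Cubes and Lebesgue measure in R^d *)

Section euclidean.
Context {R : realType} {d : nat}.
Notation Rd := 'rV[R]_d.
Notation lambda := (@lebesgue_rV R d).

(** The domain carries a product of Borel sigma-algebras, so [continuous_measurable_rV] does not
    apply and coordinates are used. *)
Lemma measurable_addr_rV : measurable_fun setT (fun p : Rd * Rd => p.1 + p.2)%R.
Proof.
apply: measurable_fun_rV => j.
under eq_fun do rewrite mxE.
apply: measurable_funD.
  exact: (measurableT_comp (measurable_coord j) measurable_fst).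
exact: (measurableT_comp (measurable_coord j) measurable_snd).
Qed.

Lemma measurable_oppr_rV : measurable_fun setT (fun x : Rd => - x)%R.
Proof.
apply: measurable_fun_rV => j.
under eq_fun do rewrite mxE.
apply: measurableT_comp => //; exact: measurable_coord.
Qed.

Lemma measurable_funD_rV dT (T : measurableType dT) (f g : T -> Rd) :
  measurable_fun setT f -> measurable_fun setT g ->
  measurable_fun setT (fun x => f x + g x)%R.
Proof.
move=> mf mg.
exact: (measurableT_comp measurable_addr_rV (measurable_fun_pair mf mg)).
Qed.

Lemma measurable_funN_rV dT (T : measurableType dT) (f : T -> Rd) :
  measurable_fun setT f -> measurable_fun setT (fun x => - f x)%R.
Proof. exact: measurableT_comp measurable_oppr_rV. Qed.

Lemma norm_rV_le (x : Rd) (r : R) : (0 <= r)%R ->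
  (forall j, `|x ord0 j| <= r)%R -> (`|x| <= r)%R.
Proof.
move=> r0 xr; rewrite /Num.Def.normr/= mx_normrE.
by apply: bigmax_le => // -[i j] _; rewrite ord1; exact: xr.
Qed.

Lemma le_norm_rV (x : Rd) j : (`|x ord0 j| <= `|x|)%R.
Proof.
rewrite [leRHS]/Num.Def.normr/= mx_normrE.
exact: (le_bigmax _ (fun i : 'I_1 * 'I_d => `|x i.1 i.2|)%R (ord0, j)).
Qed.

Lemma norm_rV_coord (x : Rd) : x != 0%R -> exists j, `|x|%R = `|x ord0 j|%R.
Proof.
rewrite -normr_eq0 => /mx_norm_neq0[[i j] xj]; exists j.
by rewrite [LHS]xj ord1.
Qed.

(** Open balls of the sup-norm, used as the test sets of [mass_stationary] and to exhaust the space.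
    The radius [n.+1] keeps the volume positive at [n = 0]. *)
Definition cube (n : nat) : set Rd := [set x | `|x| < n.+1%:R]%R.

Lemma cubeE n : cube n =
  [set x | forall j, [set r : R | `|r| < n.+1%:R]%R (x ord0 j)].
Proof.
apply/seteqP; split => x /= h.
  by move=> j; rewrite (le_lt_trans _ h)// le_norm_rV.
have [->|x0] := eqVneq x 0%R; first by rewrite /cube/= normr0 ltr0n.
have [j xj] := norm_rV_coord x0.
by rewrite /cube/= xj; exact: h.
Qed.

Lemma open_cube n : open (cube n).
Proof.
rewrite (_ : cube n = (fun x : Rd => `|x|%R) @^-1` [set r | (r < n.+1%:R)%R])//.
move: (@norm_continuous R Rd) => /continuousP; apply; exact: open_lt.
Qed.

Lemma measurable_cube n : measurable (cube n).
Proof. by apply: open_measurable_rV; exact: open_cube. Qed.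

Lemma bounded_cube n : bounded_set (cube n).
Proof.
exists n.+1%:R; split; first exact: num_real.
by move=> r nr x /= xn; rewrite ltW// (lt_trans xn).
Qed.

Lemma nondecreasing_cube m n : (m <= n)%N -> cube m `<=` cube n.
Proof. by move=> mn x xm; apply: (lt_le_trans xm); rewrite ler_nat. Qed.

Lemma bigcup_cube : \bigcup_n cube n = setT.
Proof.
apply/seteqP; split => // x _; exists (Num.truncn `|x|%R) => //=.
exact: truncnS_gt.
Qed.

Lemma prod_ereal_eq0 (I : finType) (F : I -> \bar R) i :
  F i = 0 -> \prod_j F j = 0.
Proof. by move=> Fi; rewrite (bigD1 i)//= Fi mul0e. Qed.

Lemma lebesgue_rV_hyperplane (j : 'I_d) (r : R) :
  lambda [set x | x ord0 j = r] = 0.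
Proof.
pose A i : set R := if i == j then [set r] else setT.
transitivity (lambda [set x | forall i, A i (x ord0 i)]).
  congr (lambda _).
  apply/seteqP; split => x /=.
    by move=> xj i; rewrite /A; case: eqP => [->|].
  by move=> /(_ j); rewrite /A eqxx.
rewrite lebesgue_rV_box; last by move=> i; rewrite /A; case: ifP.
apply: (prod_ereal_eq0 (i := j)).
by rewrite /A eqxx lebesgue_measure_set1.
Qed.

Lemma lebesgue_rV_hyperplanes (N : set Rd) (r s : R) :
  measurable N -> N `<=` [set x | exists j, x ord0 j = r \/ x ord0 j = s] ->
  lambda N = 0.
Proof.
move=> mN Nrs.
pose H (a : R) (j : 'I_d) : set Rd := [set x | x ord0 j = a].
have mH a j : measurable (H a j).
  rewrite -[X in measurable X]setTI.
  exact: (measurable_coord j measurableT (measurable_set1 a)).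
apply/eqP; rewrite -measure_le0.
pose F (p : 'I_d * bool) := H (if p.2 then r else s) p.1.
have NF : N `<=` \bigcup_(p in setT) F p.
  move=> x /Nrs[j [xj|xj]]; [exists (j, true)|exists (j, false)] => //.
have := @content_sub_fsum _ _ _ lambda _ setT N F finite_finset
  (fun p _ => mH (if p.2 then r else s) p.1) mN NF.
by rewrite fsbig1// => p _; exact: lebesgue_rV_hyperplane.
Qed.

(** A boundary point has sup-norm exactly [n.+1], attained at some coordinate, so the boundary lies
    in finitely many hyperplanes. *)
Lemma lebesgue_rV_boundary_cube n : lambda (boundary (cube n)) = 0.
Proof.
apply: (@lebesgue_rV_hyperplanes _ (n.+1%:R) (- n.+1%:R)%R).
  apply: measurableD; last by apply: open_measurable_rV; exact: open_interior.
  rewrite -[X in measurable X]setCK; apply: measurableC.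
  apply: open_measurable_rV; apply: closed_openC; exact: closed_closure.
move=> x [cx]; rewrite ((interior_id (cube n)).1 (@open_cube n)) /cube /= => /negP.
rewrite -leNgt => nx.
have {cx}xn : (`|x| <= n.+1%:R)%R.
  have cl : closed [set y : Rd | `|y| <= n.+1%:R]%R.
    rewrite (_ : mkset _ = (fun x : Rd => `|x|%R) @^-1` [set r | (r <= n.+1%:R)%R])//.
    apply: closed_comp; last exact: closed_le.
    by move=> y _; exact: norm_continuous.
  suff : [set y : Rd | `|y| <= n.+1%:R]%R x by [].
  rewrite ((closure_id _).1 cl); move: cx; apply: closureS => y.
  exact: ltW.
have xE : `|x|%R = n.+1%:R by apply/eqP; rewrite eq_le xn nx.
have x0 : x != 0%R by rewrite -normr_eq0 xE.
have [j xj] := norm_rV_coord x0.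
exists j; move: xE; rewrite xj.
by case: ler0P => _ <-; [right|left]; rewrite ?opprK.
Qed.

End euclidean.

Section lebesgue_euclidean.
Context {R : realType} {d : nat}.
Notation Rd := 'rV[R]_d.
Notation lambda := (@lebesgue_rV R d).

Lemma lebesgue_cube n : lambda (cube n) = \prod_(j < d) (n.+1%:R *+ 2)%:E.
Proof.
have E : [set r : R | `|r| < n.+1%:R]%R = [set` `]- n.+1%:R, n.+1%:R[%R].
  by apply/seteqP; split => r; rewrite /= in_itv/= ltr_norml.
rewrite cubeE (lebesgue_rV_box (A := fun=> [set r : R | `|r| < n.+1%:R]%R)).
  apply: eq_bigr => j _.
  rewrite E lebesgue_measure_itv/= lte_fin gtrN ?ltr0n//.
  by rewrite -EFinB opprK -mulr2n.
by move=> j; rewrite E.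
Qed.

Lemma lebesgue_cube_gt0 n : 0 < lambda (cube n).
Proof.
by rewrite lebesgue_cube prodEFin lte_fin prodr_gt0.
Qed.

Lemma lebesgue_cube_lty n : lambda (cube n) < +oo.
Proof. by rewrite lebesgue_cube prodEFin ltry. Qed.

Lemma measurable_unit_cube : measurable (@unit_cube R d).
Proof.
rewrite (_ : unit_cube = \bigcap_j ((fun x : Rd => x ord0 j) @^-1` [set` `[0%R, 1%R[%R])).
  apply: fin_bigcap_measurable => // j _.
  by rewrite -[X in measurable X]setTI; apply: measurable_coord.
apply/seteqP; split => x h j.
  by move=> _; rewrite /= in_itv; exact: h.
by have := h j I; rewrite /= in_itv.
Qed.

Lemma bounded_unit_cube : bounded_set (@unit_cube R d).
Proof.
exists 1%R; split => // r r1 x xQ; apply: norm_rV_le.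
  by rewrite (le_trans _ (ltW r1)).
move=> j; have /andP[x0 x1] := xQ j.
by rewrite ger0_norm// ltW// (lt_trans x1).
Qed.

Lemma lebesgue_unit_cube : lambda unit_cube = 1.
Proof.
rewrite (_ : unit_cube = [set x : Rd | forall j, [set` `[0%R, 1%R[%R] (x ord0 j)]).
  rewrite (lebesgue_rV_box (A := fun=> [set` `[0%R, 1%R[%R]))// big1// => j _.
  by rewrite lebesgue_measure_itv/= lte_fin ltr01 -EFinB subr0.
by apply/seteqP; split => x h j; have := h j; rewrite /= in_itv.
Qed.

Lemma lebesgue_rV_negligible_coord0 (N : set Rd) :
  measurable N -> N `<=` [set x | exists j, x ord0 j = 0%R] -> lambda N = 0.
Proof.
move=> mN N0; apply: (lebesgue_rV_hyperplanes (r := 0%R) (s := 0%R)) => //.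
by move=> x /N0[j ?]; exists j; left.
Qed.

End lebesgue_euclidean.

(** * Translation invariance of Lebesgue measure *)

Section translation.
Context {R : realType}.

Lemma lebesgue_measure_translate (a : R) (A : set R) : measurable A ->
  lebesgue_measure ((fun x => x + a)%R @^-1` A) = lebesgue_measure A.
Proof.
move=> mA; have ma : measurable_fun setT
    (fun x : measurableTypeR R => (x + a)%R : measurableTypeR R).
  exact: measurable_funD.
rewrite -[LHS]/(image_measure (@lebesgue_measure R) ma A).
apply/esym/(@lebesgue_measure_unique _ (image_measure _ ma)) => //= _ [[u v] _ <-].
rewrite /image_measure/= /pushforward.
rewrite (_ : _ @^-1` _ = [set` `]u - a, v - a]%R]).
  rewrite !lebesgue_measure_itv/= !lte_fin ltrD2r; case: ifP => // _.
  by rewrite -!EFinB opprB addrA subrK.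
by apply/seteqP; split => x; rewrite /= !in_itv/= ltrBlDr lerBrDr.
Qed.

(** Induction on the dimension: a translation acts separately on the first coordinate and on the
    rest, so uniqueness of the product measure applies. *)
Lemma lebesgue_rV_translate d (a : 'rV[R]_d) (A : set 'rV[R]_d) :
  measurable A -> lebesgue_rV R d ((fun x => x + a)%R @^-1` A) = lebesgue_rV R d A.
Proof.
elim: d a A => [|n IH] a A mA.
  rewrite (_ : _ @^-1` A = A)//; apply/funext => x; rewrite /preimage/=.
  by congr A; rewrite [LHS]thinmx0 [RHS]thinmx0.
rewrite /= /lebesgue_rVS /pushforward.
have mB : measurable (@cons_rV R n @^-1` A).
  by rewrite -[X in measurable X]setTI; exact: measurable_cons_rV.
set B := _ @^-1` A in mB *.
have ma1 : measurable_fun setT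
    (fun x : measurableTypeR R => (x + a ord0 ord0)%R : measurableTypeR R).
  exact: measurable_funD.
pose a' : 'rV[R]_n := \row_k a ord0 (lift ord0 k).
have ma2 : measurable_fun setT (fun x : 'rV[R]_n => x + a')%R.
  exact: measurable_funD_rV.
have mp : measurable_fun setT
    (fun p : measurableTypeR R * 'rV[R]_n =>
      ((p.1 + a ord0 ord0, p.2 + a')%R : measurableTypeR R * 'rV[R]_n)).
  apply: measurable_fun_pair.
    exact: (measurableT_comp ma1 measurable_fst).
  exact: (measurableT_comp ma2 measurable_snd).
rewrite (_ : _ @^-1` _ = (fun p => (p.1 + a ord0 ord0, p.2 + a')%R) @^-1` B).
  rewrite -[LHS]/(image_measure (@lebesgue_measure R \x lebesgue_rV R n) mp B).
  apply/esym/(@product_measure_unique _ _ _ _ _ _ _ (image_measure _ mp)) => // X Y mX mY.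
  rewrite /image_measure/= /pushforward.
  rewrite (_ : _ @^-1` _ = ((fun x => x + a ord0 ord0)%R @^-1` X) `*`
    ((fun x => x + a')%R @^-1` Y))//.
  rewrite product_measure1E ?IH//.
  - by congr (_ * _); exact: lebesgue_measure_translate.
  - by rewrite -[X in measurable X]setTI; exact: ma1.
  - by rewrite -[X in measurable X]setTI; exact: ma2.
apply/seteqP; split => -[x v]; rewrite /B /preimage/=;
  congr A; apply/rowP => j; rewrite !mxE; case: unliftP => [k|] ->; by rewrite ?mxE.
Qed.

Lemma integral_lebesgue_rV_translate d (a : 'rV[R]_d) (f : 'rV[R]_d -> \bar R) :
  measurable_fun setT f -> (forall x, 0 <= f x) ->
  \int[lebesgue_rV R d]_x f (x + a)%R = \int[lebesgue_rV R d]_x f x.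
Proof.
move=> mf f0.
have ma : measurable_fun setT (fun x : 'rV[R]_d => x + a)%R.
  exact: measurable_funD_rV.
rewrite -(integral_image_measure _ ma)//.
by apply: eq_measure_integral => A mA _; exact: lebesgue_rV_translate.
Qed.

End translation.

(** * Locally finite measures as kernels *)

Section tonelli.
Context d1 d2 (T1 : measurableType d1) (T2 : measurableType d2) {R : realType}.

(** Fubini-Tonelli expects bundled sigma-finite measures; the copy bundles a measure with a proof
    that is available only as a hypothesis. *)
Definition sigma_finite_copy d (T : measurableType d)
    (mu : {measure set T -> \bar R}) (mu_sf : sigma_finite setT mu) :
  set T -> \bar R := mu.

HB.instance Definition _ d (T : measurableType d)
    (mu : {measure set T -> \bar R}) (mu_sf : sigma_finite setT mu) :=
  Measure.copy (sigma_finite_copy mu_sf) mu.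

HB.instance Definition _ d (T : measurableType d)
    (mu : {measure set T -> \bar R}) (mu_sf : sigma_finite setT mu) :=
  @Measure_isSigmaFinite.Build _ _ _ (sigma_finite_copy mu_sf) mu_sf.

Lemma sigma_finite_tonelli (mu : {measure set T1 -> \bar R})
    (nu : {measure set T2 -> \bar R}) (f : T1 * T2 -> \bar R) :
  sigma_finite setT mu -> sigma_finite setT nu ->
  measurable_fun setT f -> (forall x, 0 <= f x) ->
  \int[mu]_x \int[nu]_y f (x, y) = \int[nu]_y \int[mu]_x f (x, y).
Proof.
move=> sf1 sf2 mf f0.
exact: (fubini_tonelli (m1 := sigma_finite_copy sf1)
  (m2 := sigma_finite_copy sf2)).
Qed.

End tonelli.

Section random_measures.
Context {R : realType} {d : nat}.
Notation Rd := 'rV[R]_d.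
Notation M := (lfmeasure R d).

(** Agreement is asked on all sets, measurable or not, since measures are compared as functions; the
    shift identities below hold for every set. *)
Lemma lfmeasure_eq (mu nu : M) : (forall B, mu B = nu B) -> mu = nu.
Proof.
case: mu nu => [mu muf] [nu nuf] /= munu.
have E : mu = nu by apply: eq_measure; exact/funext.
by subst nu; congr LFMeasure; exact: Prop_irrelevance.
Qed.

Lemma shift_measure0 (mu : M) : shift_measure 0 mu = mu.
Proof.
apply: lfmeasure_eq => B /=; rewrite /shift_fun /pushforward; congr (mu _).
by apply/funext => x; rewrite /preimage/= subr0.
Qed.

Lemma shift_measureD (s t : Rd) (mu : M) :
  shift_measure (s + t) mu = shift_measure s (shift_measure t mu).
Proof.
apply: lfmeasure_eq => B /=; rewrite /shift_fun /pushforward; congr (mu _).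
by apply/funext => x; rewrite /preimage/= opprD addrA addrAC.
Qed.

Lemma lfmeasure_sigma_finite (mu : M) : sigma_finite setT mu.
Proof.
exists cube; first by rewrite bigcup_cube.
move=> n; split; first exact: measurable_cube.
by apply: lfmeasure_fin; [exact: measurable_cube|exact: bounded_cube].
Qed.

Lemma integral_shift_measure (t : Rd) (mu : M) (f : Rd -> \bar R) :
  measurable_fun setT f -> (forall x, 0 <= f x) ->
  \int[shift_measure t mu]_x f x = \int[mu]_x f (x - t)%R.
Proof.
move=> mf f0.
by rewrite -(integral_image_measure mu (measurable_subr t)).
Qed.

Lemma measurable_lfmeasure_eval B : measurable B ->
  measurable_fun setT (fun mu : M => mu B).
Proof.
move=> mB _ A mA; rewrite setTI; apply: sub_sigma_algebra.
by exists B => //; exists A => //; rewrite setTI.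
Qed.

Section measurable_integral.
Context dX (X : measurableType dX) (z : X -> M).
Hypothesis mz : measurable_fun setT z.

(** The masses [z x (cube n)] need not be bounded in [x]. Conditioning on the cube gives a finite
    kernel, and the mass, measurable in [x], is multiplied back; where it is 0 both sides vanish. *)
Lemma measurable_integral_lfmeasure_cube n (f : X * Rd -> \bar R) :
  measurable_fun setT f -> (forall x, 0 <= f x) ->
  measurable_fun setT (fun x => \int[z x]_(v in cube n) f (x, v)).
Proof.
move=> mf f0.
pose zm x : {measure set Rd -> \bar R} := z x.
have mzA B : measurable B -> measurable_fun setT (fun x => zm x (B `&` cube n)).
  move=> mB; apply: (measurableT_comp (measurable_lfmeasure_eval _) mz).
  by apply: measurableI => //; exact: measurable_cube.
pose k := conditioning_kernel (fun=> measurable_cube n) mzA.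
have mzc : measurable_fun setT (fun x => zm x (cube n)).
  exact: (measurableT_comp (measurable_lfmeasure_eval (measurable_cube n)) mz).
rewrite (_ : (fun x => _) = fun x => z x (cube n) * \int[k x]_v f (x, v)).
  apply: emeasurable_funM => //.
  exact: measurable_fun_integral_finite_kernel.
apply/funext => x.
have mfx : measurable_fun setT (fun v => f (x, v)) by exact: measurableT_comp.
rewrite integral_conditioning_kernel// -/(zm x).
have zoo : zm x (cube n) < +oo.
  by apply: lfmeasure_fin; [exact: measurable_cube|exact: bounded_cube].
have [z0|z0] := eqVneq (zm x (cube n)) 0.
  rewrite z0 mul0e; apply: null_set_integral => //.
    exact: measurable_cube.
  exact: measurable_funTS.
by rewrite muleA divee ?mul1e// ge0_fin_numE.
Qed.

Lemma measurable_integral_lfmeasure (f : X * Rd -> \bar R) :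
  measurable_fun setT f -> (forall x, 0 <= f x) ->
  measurable_fun setT (fun x => \int[z x]_v f (x, v)).
Proof.
move=> mf f0.
apply: (emeasurable_fun_cvg (fun n x => \int[z x]_(v in cube n) f (x, v))).
  by move=> n; exact: measurable_integral_lfmeasure_cube.
move=> x _; rewrite -bigcup_cube.
apply: ge0_nondecreasing_set_cvg_integral.
- by move=> m n mn; apply/subsetPset; exact: nondecreasing_cube.
- by move=> n; exact: measurable_cube.
- by move=> n; apply: measurable_funTS; exact: measurableT_comp.
- by move=> n v _; exact: f0.
Qed.

End measurable_integral.

(** On a generating set [B] the shifted mass is the integral of the indicator of [B] at [v - t x]
    against [z x], so joint measurability reduces to that of a parameter integral. *)
Lemma measurable_shift_measure dX (X : measurableType dX) (t : X -> Rd)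
    (z : X -> M) : measurable_fun setT t -> measurable_fun setT z ->
  measurable_fun setT (fun x => shift_measure (t x) (z x)).
Proof.
move=> mt mz.
pose G := \bigcup_(B in @measurable _ Rd)
  preimage_set_system [set: M] (fun xi : M => xi B) measurable.
apply: (measurability G) => // _ [A [B mB [D mD <-]] <-].
rewrite !setTI -comp_preimage -[X in measurable X]setTI.
have : measurable_fun setT (fun x => shift_measure (t x) (z x) B); last exact.
pose f (p : X * Rd) : \bar R := (\1_B (p.2 - t p.1)%R)%:E.
rewrite (_ : (fun x => _) = fun x => \int[z x]_v f (x, v)).
  apply: measurable_integral_lfmeasure => //.
    apply/measurable_EFinP.
    have mpt : measurable_fun setT (fun p : X * Rd => p.2 - t p.1)%R.
      apply: measurable_funD_rV => //.
      by apply: measurable_funN_rV; exact: (measurableT_comp mt).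
    exact: (measurableT_comp (measurable_indic mB) mpt).
  by move=> p; rewrite lee_fin.
apply/funext => x; rewrite -(setIT B) -integral_indic//.
rewrite integral_shift_measure//.
exact/measurable_EFinP.
Qed.

End random_measures.

(** * Voronoi cells of the lattice *)

Section voronoi.
Context {R : realType} {d : nat}.
Notation Rd := 'rV[R]_d.
Notation M := (lfmeasure R d).
Notation Zd := 'rV[int]_d.
Notation lattice := (@lattice R d).
Notation lattice_dist := (@lattice_dist R d).
Implicit Types (i j k s : Zd) (N : set Zd).

Lemma latticeD i j : lattice (i + j) = (lattice i + lattice j)%R.
Proof. by apply/rowP => l; rewrite !mxE intrD. Qed.

Lemma latticeN i : lattice (- i) = (- lattice i)%R.
Proof. by apply/rowP => l; rewrite !mxE intrN. Qed.

Lemma lattice0 : lattice 0 = 0%R.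
Proof. by apply/rowP => l; rewrite !mxE. Qed.

Lemma lattice_inj : injective lattice.
Proof.
move=> i j /rowP ij; apply/rowP => l; have := ij l.
by rewrite !mxE => /eqP; rewrite eqr_int => /eqP.
Qed.

(** Natural numbers are well-ordered, so nearest points exist by [ex_minnP]. *)
Definition sqdist i j : nat := \sum_l (absz (i ord0 l - j ord0 l)%R ^ 2)%N.

Lemma lattice_distE i j : lattice_dist i j = Num.sqrt (sqdist i j)%:R.
Proof.
rewrite /Defs.lattice_dist natr_sum; congr Num.sqrt; apply: eq_bigr => l _.
by rewrite natrX natr_absz intr_norm real_normK// num_real.
Qed.

Lemma lattice_dist_le i j k :
  (lattice_dist i j <= lattice_dist i k)%R = (sqdist i j <= sqdist i k)%N.
Proof. by rewrite !lattice_distE ler_sqrt// ler_nat. Qed.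

Lemma lattice_dist_eq i j k :
  lattice_dist i k = lattice_dist i j <-> sqdist i k = sqdist i j.
Proof.
split=> [E|]; last by rewrite !lattice_distE => ->.
by apply/eqP; rewrite eqn_leq -!lattice_dist_le E lexx.
Qed.

Lemma sqdist_shift i j s : sqdist (i + s) (j + s) = sqdist i j.
Proof.
by apply: eq_bigr => l _; rewrite !mxE opprD addrACA subrr addr0.
Qed.

Lemma sqdist_eq0 i j : sqdist i j = 0%N -> i = j.
Proof.
move=> /eqP; rewrite sum_nat_eq0 => /forallP ij; apply/rowP => l.
have := ij l; rewrite /= expn_eq0 andbT absz_eq0 subr_eq0 => /eqP.
exact.
Qed.

Lemma sqdistii i : sqdist i i = 0%N.
Proof. by rewrite /sqdist big1// => l _; rewrite subrr. Qed.

Lemma lex_lt_shift i j s : lex_lt (i + s)%R (j + s)%R <-> lex_lt i j.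
Proof.
split=> -[l [ijl lij]]; exists l; split=> [m ml|].
- by have := ijl m ml; rewrite !mxE => /addIr.
- by move: lij; rewrite !mxE ltrD2r.
- by rewrite !mxE ijl.
- by rewrite !mxE ltrD2r.
Qed.

Lemma lex_lt_asym i j : lex_lt i j -> lex_lt j i -> False.
Proof.
move=> [l [ijl lij]] [m [jim mji]].
case: (ltngtP l m) => [lm|ml|/val_inj lm].
- by move: lij; rewrite jim// ltxx.
- by move: mji; rewrite ijl// ltxx.
- by move: mji; rewrite -lm ltNge (ltW lij).
Qed.

(** The common lower bound [m] replaces well-foundedness, which fails on the whole lattice.
    Coordinates are minimized one after the other: after [p] of them, each point of [N] either
    agrees with [j] on these or exceeds it at the first difference. *)
Lemma lex_lt_min N (m : int) : N !=set0 ->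
  (forall k l, N k -> m <= k ord0 l)%R ->
  exists2 j, N j & forall k, N k -> k = j \/ lex_lt j k.
Proof.
move=> N0 mN.
suff H p : (p <= d)%N -> exists2 j, N j & forall k, N k ->
    (forall l : 'I_d, (l < p)%N -> k ord0 l = j ord0 l) \/
    exists l : 'I_d, [/\ (l < p)%N,
      forall l' : 'I_d, (l' < l)%N -> j ord0 l' = k ord0 l' &
      (j ord0 l < k ord0 l)%R].
  have [j Nj jN] := H d (leqnn d); exists j => // k /jN[kj|[l [_ ? ?]]].
    by left; apply/rowP => l; exact: kj.
  by right; exists l.
elim: p => [_|p IH pd].
  by have [j Nj] := N0; exists j => // k _; left.
have [j Nj jN] := IH (ltnW pd).
(* Coordinate [p] is minimized among the points still tied with [j]; its distance to [m] is a
   natural number. *)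
pose P n := `[< exists2 k, N k & (forall l : 'I_d, (l < p)%N ->
  k ord0 l = j ord0 l) /\ absz (k ord0 (Ordinal pd) - m)%R = n >].
have exP : exists n, P n.
  by exists (absz (j ord0 (Ordinal pd) - m)%R); apply/asboolP; exists j.
case: (ex_minnP exP) => n /asboolP[j' Nj' [j'j j'n]] nmin.
exists j' => // k Nk.
have [kj|[l [lp jkl ljk]]] := jN k Nk; last first.
  right; exists l; split; first exact: ltnW.
    by move=> l' l'l; rewrite -jkl// j'j// (ltn_trans l'l).
  by rewrite j'j.
have : (j' ord0 (Ordinal pd) <= k ord0 (Ordinal pd))%R.
  rewrite -(lerD2r (- m)%R) -[leLHS]gez0_abs ?subr_ge0 ?mN//.
  rewrite -[leRHS]gez0_abs ?subr_ge0 ?mN// lez_nat j'n; apply: nmin.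
  by apply/asboolP; exists k.
rewrite le_eqVlt => /predU1P[j'k|j'k].
  left => l; rewrite ltnS leq_eqVlt => /predU1P[lp|lp].
    by rewrite (_ : l = Ordinal pd)//; exact: val_inj.
  by rewrite kj// j'j.
by right; exists (Ordinal pd); split => // l lp; rewrite j'j// kj.
Qed.

Lemma voronoi_center_exists N i : N !=set0 -> exists j, voronoi_center R N i j.
Proof.
move=> [k0 Nk0].
pose P n := `[< exists2 k, N k & sqdist i k = n >].
have exP : exists n, P n by exists (sqdist i k0); apply/asboolP; exists k0.
case: (ex_minnP exP) => n /asboolP[k1 Nk1 k1n] nmin.
(* An integer is at most its square in absolute value, so a point at squared distance [n] has
   coordinates at least [i_l - n]. The starting value 0 of the minimum can only lower the bound. *)
have [|k l [_ kn]|j [Nj jn] jN] :=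
  @lex_lt_min (N `&` [set k | sqdist i k = n])
    (\big[Order.min/0%R]_(l < d) i ord0 l - n%:Z)%R.
- by exists k1.
- have il : (\big[Order.min/0%R]_(l < d) i ord0 l <= i ord0 l)%R.
    exact: bigmin_le_cond.
  rewrite lerBlDr (le_trans il)//.
  rewrite -lerBlDl (le_trans (lez_abs _))// lez_nat -kn.
  rewrite /sqdist (bigD1 l)//= (leq_trans _ (leq_addr _ _))//.
  by case: (absz _) => // a; rewrite leq_pmull.
exists j; split => // k Nk.
  by rewrite lattice_dist_le jn nmin//; apply/asboolP; exists k.
by move/lattice_dist_eq => kj; apply: jN; split => //=; rewrite kj.
Qed.

Lemma voronoi_center_unique N i j j' :
  voronoi_center R N i j -> voronoi_center R N i j' -> j = j'.
Proof.
move=> [Nj ij lj] [Nj' ij' lj'].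
have E : lattice_dist i j = lattice_dist i j'.
  by apply/eqP; rewrite eq_le ij// ij'.
have [->//|jj'] := lj j' Nj' (esym E).
have [->//|j'j] := lj' j Nj E.
by have := lex_lt_asym jj' j'j.
Qed.

Lemma voronoi_center_self N i : N i -> voronoi_center R N i i.
Proof.
move=> Ni; split=> // k Nk; first by rewrite lattice_dist_le sqdistii.
by move/lattice_dist_eq; rewrite sqdistii => /sqdist_eq0; left.
Qed.

(** Distances and the lexicographic order are both translation invariant, so the tie-breaking moves
    along with the process. *)
Lemma voronoi_center_shift N s i j :
  voronoi_center R [set k | N (k + s)%R] i j <->
  voronoi_center R N (i + s)%R (j + s)%R.
Proof.
split=> -[Nj ij lj]; split => // k Nk.
- have := ij (k - s)%R; rewrite /= subrK => /(_ Nk).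
  by rewrite !lattice_dist_le -(sqdist_shift i _ s) -(sqdist_shift i _ s) subrK.
- have := lj (k - s)%R; rewrite /= subrK => /(_ Nk) kj E.
  have [|kjs|jk] := kj.
  + by move/lattice_dist_eq: E => E; apply/lattice_dist_eq;
      rewrite -[LHS](sqdist_shift _ _ s) -[RHS](sqdist_shift _ _ s) subrK.
  + by left; rewrite -kjs subrK.
  + by right; rewrite -(subrK s k); apply/lex_lt_shift.
- have := ij (k + s)%R Nk.
  by rewrite !lattice_dist_le !sqdist_shift.
- move=> E; have [|/addIr|/lex_lt_shift] := lj (k + s)%R Nk; [|by left|by right].
  by move/lattice_dist_eq: E => E; apply/lattice_dist_eq; rewrite !sqdist_shift.
Qed.

Lemma voronoi_cell0E N i : N 0%R ->
  voronoi_cell0 R N i <-> voronoi_center R N i 0%R.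
Proof.
move=> N0; split=> [[j [j0 ij]]|i0].
  by rewrite (voronoi_center_unique (voronoi_center_self N0) j0).
by exists 0%R; split => //; exact: voronoi_center_self.
Qed.

Lemma cube_processE (mu : M) i :
  cube_process mu i = (0 < shift_measure (lattice i) mu unit_cube) :> Prop.
Proof.
rewrite /cube_process/= shift_funE.
by rewrite (eq_imagel (fun x _ => addrC (lattice i) x)).
Qed.

Lemma cube_process_shift (mu : M) s :
  cube_process (shift_measure (lattice s) mu) =
  [set k | cube_process mu (k + s)%R].
Proof.
apply/funext => i; rewrite cube_processE -shift_measureD -latticeD.
by rewrite -cube_processE.
Qed.

(** Total by [xget]. The default, used when the process is empty, is again a lattice point, on which
    the splitting in [integral_construction] relies. *)
Definition voronoi_center0 (mu : M) : Rd :=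
  lattice (xget 0%R (voronoi_center R (cube_process mu) 0%R)).

Lemma voronoi_center0P (mu : M) j :
  voronoi_center R (cube_process mu) 0%R j -> voronoi_center0 mu = lattice j.
Proof.
move=> cj; rewrite /voronoi_center0; congr lattice.
by case: xgetP => [k _ ck|/(_ j)//]; exact: (voronoi_center_unique ck cj).
Qed.

End voronoi.

(** * Measurability and finiteness questions for the Voronoi cell *)

Section voronoi_measurable.
Context {R : realType} {d : nat}.
Notation Rd := 'rV[R]_d.
Notation M := (lfmeasure R d).
Notation Zd := 'rV[int]_d.
Notation lattice := (@lattice R d).

Lemma measurable_countable_exists dT (T : measurableType dT) (I : countType)
    (F : I -> set T) :
  (forall i, measurable (F i)) -> measurable [set x | exists i, F i x].
Proof.
move=> mF; rewrite (_ : mkset _ = \bigcup_i F i).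
  by apply: countable_bigcupT_measurable => //; exact: countableP.
by apply/seteqP; split => [x [i ?]|x [i _ ?]]; exists i.
Qed.

Lemma measurable_countable_forall dT (T : measurableType dT) (I : countType)
    (F : I -> set T) :
  (forall i, measurable (F i)) -> measurable [set x | forall i, F i x].
Proof.
move=> mF; rewrite (_ : mkset _ = ~` [set x | exists i, (~` F i) x]).
  by apply: measurableC; apply: measurable_countable_exists => i;
    exact: measurableC.
apply/seteqP; split => x /= => [Fx [i]|/forallNP Fx i]; first exact.
by have /contrapT := Fx i.
Qed.

Lemma measurable_imply dT (T : measurableType dT) (A B : set T) :
  measurable A -> measurable B -> measurable [set x | A x -> B x].
Proof.
move=> mA mB; rewrite (_ : mkset _ = ~` A `|` B).
  by apply: measurableU => //; exact: measurableC.
apply/seteqP; split => x /=; last by case.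
by case: (pselect (A x)) => [Ax /(_ Ax)|]; [right|left].
Qed.

Lemma measurable_const dT (T : measurableType dT) (Q : Prop) :
  measurable [set _ : T | Q].
Proof.
have [q|q] := pselect Q.
  by rewrite (_ : mkset _ = setT)//; apply/seteqP; split.
by rewrite (_ : mkset _ = set0)//; apply/seteqP; split.
Qed.

Lemma measurable_set1_rV (x : Rd) : measurable [set x].
Proof.
rewrite (_ : [set x] = \bigcap_j ((fun y : Rd => y ord0 j) @^-1` [set x ord0 j])).
  apply: fin_bigcap_measurable => // j _.
  by rewrite -[X in measurable X]setTI; exact: (measurable_coord j).
by apply/seteqP; split => [y ->//|y h]; apply/rowP => j; exact: h.
Qed.

Lemma measurable_cube_process (i : Zd) :
  measurable [set mu : M | cube_process mu i].
Proof.
pose f (mu : M) := shift_measure (lattice i) mu unit_cube.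
rewrite (_ : mkset _ = [set mu | 0 < f mu]).
  rewrite -[X in measurable X]setTI.
  apply: emeasurable_fun_o_infty => //.
  apply: (measurableT_comp (measurable_lfmeasure_eval measurable_unit_cube)).
  exact: measurable_shift_measure.
by apply/seteqP; split => mu; rewrite /= cube_processE.
Qed.

Lemma measurable_voronoi_center (i j : Zd) :
  measurable [set mu : M | voronoi_center R (cube_process mu) i j].
Proof.
rewrite (_ : mkset _ = [set mu : M | cube_process mu j] `&`
  ([set mu | forall k : Zd, cube_process mu k ->
     (lattice_dist R i j <= lattice_dist R i k)%R] `&`
   [set mu | forall k : Zd, cube_process mu k ->
     lattice_dist R i k = lattice_dist R i j -> k = j \/ lex_lt j k])).
  apply: measurableI; first exact: measurable_cube_process.
  apply: measurableI; apply: measurable_countable_forall => k;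
    apply: measurable_imply => //; try exact: measurable_cube_process;
    exact: measurable_const.
by apply/seteqP; split => mu /=; [case=> ? ? ?|case=> ? [? ?]].
Qed.

Lemma measurable_voronoi_center0 :
  measurable_fun setT (@voronoi_center0 R d).
Proof.
move=> _ B mB; rewrite setTI.
pose C (mu : M) := voronoi_center R (cube_process mu) 0%R.
have mC j : measurable [set mu : M | C mu j].
  exact: measurable_voronoi_center.
have mNC : measurable [set mu : M | ~ exists j, C mu j].
  by apply: measurableC; exact: measurable_countable_exists.
rewrite (_ : _ @^-1` B =
  [set mu | exists j, ([set _ : M | B (lattice j)] `&` [set mu | C mu j]) mu] `|`
  ([set mu | ~ exists j, C mu j] `&` [set _ | B (lattice 0)])).
  apply: measurableU; last by apply: measurableI => //; exact: measurable_const.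
  apply: measurable_countable_exists => j.
  by apply: measurableI => //; exact: measurable_const.
apply/seteqP; split => mu /=.
  have [[j Cj]|nC] := pselect (exists j, C mu j).
    by rewrite (voronoi_center0P Cj); left; exists j.
  rewrite /voronoi_center0; case: xgetP => [j _ Cj|_ Bmu]; last by right.
  by case: nC; exists j.
move=> [[j [Bj Cj]]|[nC B0]]; first by rewrite (voronoi_center0P Cj).
rewrite /voronoi_center0; case: xgetP => // j _ Cj.
by case: nC; exists j.
Qed.

(** As 0 is a point of the process it is its own centre, so [s] lies in the cell iff its centre is
    0. Shifting by [s] takes [s] to 0 and this centre to [- s]. *)
Lemma zero_cellE (mu : M) (s : Zd) : cube_process mu 0%R ->
  zero_cell mu (lattice s) <->
  voronoi_center0 (shift_measure (lattice s) mu) = (- lattice s)%R.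
Proof.
move=> N0; have cE j : voronoi_center R (cube_process (shift_measure (lattice s) mu))
    0%R j <-> voronoi_center R (cube_process mu) s (j + s)%R.
  by rewrite cube_process_shift voronoi_center_shift add0r.
split=> [[i /(voronoi_cell0E _ N0) i0 /lattice_inj is_]|cs].
  subst i; rewrite (@voronoi_center0P _ _ _ (- s)%R) ?latticeN//.
  by apply/cE; rewrite addNr.
(* Rules out that [voronoi_center0] takes its value by default: the point 0 of the original process
   has become the point [- s]. *)
have [j cj] : exists j, voronoi_center R
    (cube_process (shift_measure (lattice s) mu)) 0%R j.
  apply: voronoi_center_exists; exists (- s)%R.
  by rewrite cube_process_shift /= addNr.
exists s => //; apply/voronoi_cell0E => //.
move: cs; rewrite (voronoi_center0P cj) -latticeN => /lattice_inj js.
by move/cE: cj; rewrite js addNr.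
Qed.

Lemma zero_cell_lattice (mu : M) x : zero_cell mu x -> exists s, x = lattice s.
Proof. by case=> s _ <-; exists s. Qed.

Lemma measurable_zero_cell (s : Zd) :
  measurable [set mu : M | zero_cell mu (lattice s)].
Proof.
rewrite (_ : mkset _ = [set mu : M | exists j,
    ([set mu : M | voronoi_center R (cube_process mu) 0%R j] `&`
     [set mu : M | voronoi_center R (cube_process mu) s j]) mu]).
  apply: measurable_countable_exists => j.
  by apply: measurableI; exact: measurable_voronoi_center.
apply/seteqP; split => mu /=; last by move=> h; exists s.
by case=> i ? /lattice_inj <-.
Qed.

(** For [0 < d] the lattice is infinite, so the enumeration can be injective and a series over it
    meets each point once. *)
Lemma lattice_enum : (0 < d)%N ->
  exists e : nat -> Rd, [/\ injective e, (forall n, exists s, e n = lattice s) &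
    forall s, exists n, e n = lattice s].
Proof.
move=> d0.
have : ([set: Zd] #= [set: nat])%card.
  apply: eq_card_nat => // finZd; apply: infinite_nat.
  apply: (finite_preimage (f := fun n => const_mx n%:Z) _ finZd).
  move=> m n _ _ /matrixP/(_ ord0 (Ordinal d0)).
  by rewrite !mxE => -[].
move=> /card_set_bijP[f [_ injf surf]].
have /choice[e eK] n : exists s, f s = n by have [s _ <-] := surf n I; exists s.
exists (lattice \o e); split.
- by move=> m n /lattice_inj emn; rewrite -(eK m) -(eK n) emn.
- by move=> n; exists (e n).
- move=> s; exists (f s); congr lattice.
  by apply: injf; rewrite ?inE// eK.
Qed.

Lemma measurable_fun_counting_zero_cell : (0 < d)%N ->
  measurable_fun setT (fun mu : M => counting (zero_cell mu) : \bar R).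
Proof.
move=> d0; have [e [injE eP eS]] := lattice_enum d0.
rewrite (_ : (fun mu : M => _) = fun mu =>
    \sum_(n <oo) (\1_[set mu : M | zero_cell mu (e n)] mu)%:E).
  apply: ge0_emeasurable_sum => [n mu _ _|n _]; first by rewrite lee_fin.
  apply/measurable_EFinP; apply: measurable_indic.
  by have [s ->] := eP n; exact: measurable_zero_cell.
apply/funext => mu.
pose F n : set Rd := zero_cell mu `&` [set e n].
have FE : zero_cell mu = \bigcup_n F n.
  apply/seteqP; split => [x zx|x [n _ []]//].
  have [s xs] := zero_cell_lattice zx; have [n en] := eS s.
  by exists n => //; split => //=; rewrite en.
have F0 n : F n = if e n \in zero_cell mu then [set e n] else set0.
  apply/seteqP; split => x; rewrite /F.
    by move=> [zx /= xe]; rewrite -xe mem_set.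
  by case: ifPn => // /set_mem ze /= ->.
have cF n : counting (F n) = (\1_[set mu : M | zero_cell mu (e n)] mu)%:E :> \bar R.
  rewrite F0 indicE (_ : (mu \in _) = (e n \in zero_cell mu)); last first.
    by apply/idP/idP => /set_mem h; apply/mem_set.
  rewrite /counting; case: (e n \in _); rewrite asboolT//.
    by rewrite fset_set1 cardfs1.
  by rewrite fset_set0.
have mF n : measurable (F n).
  by rewrite F0; case: ifPn => // _; exact: measurable_set1_rV.
rewrite {1}FE (measure_semi_bigcup (@counting Rd R))//.
- by apply: eq_eseriesr => n _; exact: cF.
- apply/trivIsetP => m n _ _ mn; rewrite -subset0 => x [[_ /= ->] [_ /= emn]].
  by move/eqP: mn; apply; exact: injE.
- exact: bigcup_measurable.
Qed.

(** The lattice translates of the unit cube cover the space, the floor of a point giving its cube;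
    if all were null, so would be [mu]. *)
Lemma cube_process_nonempty (mu : M) : (0 < d)%N ->
  mu setT != 0 -> cube_process mu !=set0.
Proof.
move=> d0; have [e [injE eP eS]] := lattice_enum d0.
apply: contraNP => N0; rewrite -measure_le0.
pose F n : set Rd := (fun x => x - e n)%R @^-1` unit_cube.
have mF n : measurable (F n).
  rewrite -[X in measurable X]setTI.
  by apply: measurable_subr => //; exact: measurable_unit_cube.
have TF : setT `<=` \bigcup_n F n.
  move=> x _; have [n en] := eS (\row_j Num.floor (x ord0 j)).
  exists n => // j; rewrite en !mxE subr_ge0 ltrBlDl.
  have /andP[xl xr] := real_floor_itv (num_real (x ord0 j)).
  by rewrite xl/= (lt_le_trans xr)// intrD1 addrC.
apply: (le_trans (measure_sigma_subadditive mu mF measurableT TF)).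
rewrite eseries0// => n _ _; apply/eqP; rewrite -measure_le0 leNgt.
apply/negP => mun; apply: N0; have [s es] := eP n.
by exists s; rewrite cube_processE -es.
Qed.

End voronoi_measurable.

(** * The weight kappa and its normalization *)

Section voronoi_weight.
Context {R : realType} {d : nat}.
Notation Rd := 'rV[R]_d.
Notation M := (lfmeasure R d).

Definition center_measure (mu : M) : M := shift_measure (voronoi_center0 mu) mu.

(* Density, with respect to mu, of mu conditioned on the unit cube of the centre
   of the cell of 0; junk for mu = 0, when there is no centre. *)
Definition voronoi_weight (mu : M) (t : Rd) : \bar R :=
  (\1_unit_cube (t - voronoi_center0 mu)%R)%:E / center_measure mu unit_cube.

Lemma voronoi_weight_ge0 mu t : 0 <= voronoi_weight mu t.
Proof. by rewrite mule_ge0 ?lee_fin ?inve_ge0. Qed.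

Lemma center_measure_fin (mu : M) : center_measure mu unit_cube < +oo.
Proof.
by apply: lfmeasure_fin; [exact: measurable_unit_cube|exact: bounded_unit_cube].
Qed.

Lemma center_measure_gt0 (mu : M) : (0 < d)%N -> mu setT != 0 ->
  0 < center_measure mu unit_cube.
Proof.
move=> d0 mu0; have N0 := cube_process_nonempty d0 mu0.
have [j cj] := voronoi_center_exists (R := R) 0%R N0.
rewrite /center_measure (voronoi_center0P cj) -cube_processE.
by case: cj.
Qed.

Section measurability.
Context dX (X : measurableType dX) (z : X -> M) (t : X -> Rd).
Hypotheses (mz : measurable_fun setT z) (mt : measurable_fun setT t).

Lemma measurable_center_measure :
  measurable_fun setT (fun x => center_measure (z x)).
Proof.
exact: (measurable_shift_measure
  (measurableT_comp measurable_voronoi_center0 mz) mz).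
Qed.

Lemma measurable_voronoi_weight :
  measurable_fun setT (fun x => voronoi_weight (z x) (t x)).
Proof.
have mtc : measurable_fun setT (fun x => t x - voronoi_center0 (z x))%R.
  apply: measurable_funD_rV => //; apply: measurable_funN_rV.
  exact: (measurableT_comp measurable_voronoi_center0 mz).
apply: emeasurable_funM.
  apply/measurable_EFinP.
  exact: (measurableT_comp (measurable_indic measurable_unit_cube) mtc).
apply: measurable_funV.
exact: (measurableT_comp (measurable_lfmeasure_eval measurable_unit_cube)
  measurable_center_measure).
Qed.

End measurability.

(** With [B := setT] this gives the normalization of kappa; for general [B] it produces the
    conditional law of T. *)
Lemma integral_voronoi_weight_indic (mu : M) (B : set Rd) : measurable B ->
  \int[mu]_t (voronoi_weight mu t * (\1_B (t - voronoi_center0 mu)%R)%:E) =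
  cond_measure (center_measure mu) unit_cube B.
Proof.
move=> mB; have mQ := @measurable_unit_cube R d.
pose f (t : Rd) : \bar R := (\1_unit_cube t)%:E * (\1_B t)%:E.
have mf : measurable_fun setT f.
  by apply: emeasurable_funM; apply/measurable_EFinP; exact: measurable_indic.
have f0 t : 0 <= f t by rewrite mule_ge0// lee_fin.
under eq_integral => t _ do rewrite /voronoi_weight muleAC -/(f _).
have mt : measurable_fun setT (fun t : Rd => t - voronoi_center0 mu)%R.
  exact: measurable_subr.
rewrite ge0_integralZr//; last 2 first.
- exact: (measurableT_comp mf mt).
- by rewrite inve_ge0.
rewrite -integral_shift_measure// /cond_measure; congr (_ / _).
rewrite -/(center_measure mu) (_ : f = fun t => (\1_(B `&` unit_cube) t)%:E).
  by rewrite integral_indic ?setIT//; exact: measurableI.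
by apply/funext => t; rewrite /f indicI /= -EFinM mulrC.
Qed.

Lemma integral_voronoi_weight (mu : M) : (0 < d)%N -> mu setT != 0 ->
  \int[mu]_t voronoi_weight mu t = 1.
Proof.
move=> d0 mu0.
have := integral_voronoi_weight_indic mu measurableT.
under eq_integral => t _ do rewrite indicT mule1.
move=> ->; rewrite /cond_measure setTI divee//.
  by rewrite ge0_fin_numE// center_measure_fin.
by rewrite gt_eqF//; exact: center_measure_gt0.
Qed.

End voronoi_weight.

(** * Mass-stationarity as a symmetry *)

Lemma integral_indicM d (T : measurableType d) {R : realType}
    (mu : {measure set T -> \bar R}) (A : set T) (f : T -> \bar R) :
  \int[mu]_(x in A) f x = \int[mu]_x ((\1_A x)%:E * f x).
Proof.
rewrite integral_mkcond; apply: eq_integral => x _.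
by rewrite patchE indicE; case: ifPn; rewrite ?mul1e ?mul0e.
Qed.

Lemma muleVI {R : realType} (a x y : \bar R) :
  0 < a -> a < +oo -> a^-1 * x = a^-1 * y -> x = y.
Proof.
move=> a0 aoo /(congr1 (fun z => a * z)).
by rewrite !muleA divee ?mul1e// ?gt_eqF// gt0_fin_numE.
Qed.

Section flow.
Context {R : realType} {d : nat} {dE : measure_display} {E : measurableType dE}.
Notation Rd := 'rV[R]_d.
Notation M := (lfmeasure R d).
Notation lambda := (@lebesgue_rV R d).
Variable theta : Rd -> E -> E.
Hypothesis theta0 : forall x, theta 0 x = x.
Hypothesis thetaD : forall s t x, theta (s + t) x = theta s (theta t x).
Hypothesis measurable_theta :
  measurable_fun setT (fun p : Rd * E => theta p.1 p.2).

Lemma shift_pair0 (y : E * M) : shift_pair theta 0 y = y.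
Proof. by case: y => x mu; rewrite /shift_pair/= theta0 shift_measure0. Qed.

Lemma shift_pairD s t (y : E * M) :
  shift_pair theta (s + t) y = shift_pair theta s (shift_pair theta t y).
Proof. by rewrite /shift_pair/= thetaD shift_measureD. Qed.

Lemma measurable_shift_pair dX (X : measurableType dX) (t : X -> Rd)
    (y : X -> E * M) : measurable_fun setT t -> measurable_fun setT y ->
  measurable_fun setT (fun x => shift_pair theta (t x) (y x)).
Proof.
move=> mt my; apply: measurable_fun_pair.
  exact: (measurableT_comp measurable_theta
    (measurable_fun_pair mt (measurableT_comp measurable_fst my))).
exact: (measurable_shift_measure mt (measurableT_comp measurable_snd my)).
Qed.

Section stationarity.
Context {dO : measure_display} {Omega : measurableType dO}.
Variables (P0 : {measure set Omega -> \bar R}).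
Variables (X0 : Omega -> E) (xi0 : Omega -> M).
Hypotheses (mX0 : measurable_fun setT X0) (mxi0 : measurable_fun setT xi0).
Hypothesis sigma_finite0 :
  sigma_finite setT (pushforward P0 (fun w => (X0 w, xi0 w))).
Hypothesis mass_stationary0 : mass_stationary theta P0 X0 xi0.

Notation Y w := (X0 w, xi0 w).
Notation Z w t := (shift_pair theta (- t) (X0 w, xi0 w)).

Let mY : measurable_fun setT (fun w => Y w).
Proof. exact: measurable_fun_pair. Qed.

Lemma measurable_translates :
  measurable_fun setT (fun p : Omega * Rd => Z p.1 p.2).
Proof.
apply: measurable_shift_pair; first exact: measurable_funN_rV.
exact: (measurableT_comp mY measurable_fst).
Qed.

Lemma measurable_lebesgue_integral (g : Omega * Rd -> \bar R) :
  measurable_fun setT g -> (forall x, 0 <= g x) ->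
  measurable_fun setT (fun w => \int[lambda]_t g (w, t)).
Proof. by move=> mg g0; exact: measurable_fun_fubini_tonelli_F. Qed.

(** [gG] sees [(Y, U)] only through the shift of [Y] by [- U], which the mass-stationary move
    preserves, and the time, which it resamples. As [G] vanishes off the cube, restrictions to the
    cube can be inserted and dropped. *)
Lemma mass_stationary_cube n (G : (E * M) * Rd -> \bar R) :
  measurable_fun setT G -> (forall x, 0 <= G x) ->
  (forall z t, ~ cube n t -> G (z, t) = 0) ->
  \int[P0]_w \int[lambda]_t G (Z w t, t) =
  \int[P0]_w \int[lambda]_t ((\1_(cube n) t)%:E * (((Z w t).2 (cube n))^-1 *
    \int[(Z w t).2]_s G (Z w t, s))).
Proof.
move=> mG G0 Gn.
have mC := @measurable_cube R d n.
have [dO1 [T1 [P' [pi [U [V h]]]]]] := mass_stationary0 mC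
  (@bounded_cube R d n) (lebesgue_cube_gt0 n) (lebesgue_rV_boundary_cube n).
case: h => mpi piE [mU mV] [condU condV] eqd.
pose Y' w := (X0 (pi w), xi0 (pi w)).
have mY' : measurable_fun setT Y' by exact: (measurableT_comp mY mpi).
have mYU : measurable_fun setT (fun w => (Y' w, U w)).
  exact: measurable_fun_pair.
have intpi (h : Omega -> \bar R) : measurable_fun setT h ->
    (forall w, 0 <= h w) -> \int[P']_w h (pi w) = \int[P0]_w h w.
  move=> mh h0; rewrite -(integral_image_measure _ mpi)//.
  by apply: eq_measure_integral => A mA _; exact: piE.
have [F FT Foo] := sigma_finite0.
have P'F k : P' (Y' @^-1` F k) < +oo.
  rewrite (_ : Y' @^-1` F k = pi @^-1` ((fun w => Y w) @^-1` F k))//.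
  rewrite piE; first exact: (Foo k).2.
  by rewrite -[X in measurable X]setTI; apply: mY => //; exact: (Foo k).1.
have sfY' : sigma_finite setT (pushforward P' Y').
  by exists F => // k; split; [exact: (Foo k).1|exact: P'F].
have sfYU : sigma_finite setT (pushforward P' (fun w => (Y' w, U w))).
  exists (fun k => F k `*` setT); first by rewrite -setX_bigcupl -FT setXTT.
  move=> k; split; first by apply: measurableX => //; exact: (Foo k).1.
  rewrite /pushforward (_ : _ @^-1` _ = Y' @^-1` F k); first exact: P'F.
  by apply/seteqP; split => [w []|w].
have mkU B : measurable B -> measurable_fun [set: E * M]
    (fun=> lambda (B `&` cube n)) by move=> mB; exact: measurable_cst.
pose kU : R.-fker (E * M) ~> Rd :=
  conditioning_kernel (z := fun=> lambda) (fun=> mC) mkU.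
have m1C : measurable_fun setT (fun u : Rd => (\1_(cube n) u)%:E : \bar R).
  by apply/measurable_EFinP; exact: measurable_indic.
have intU (g : (E * M) * Rd -> \bar R) : measurable_fun setT g ->
    (forall x, 0 <= g x) -> \int[P']_w g (Y' w, U w) =
    (lambda (cube n))^-1 *
      \int[P0]_w \int[lambda]_u ((\1_(cube n) u)%:E * g (Y w, u)).
  move=> mg g0.
  rewrite (cond_distribution_integral mY' mU (k := kU) sfY' _ condU)//; last first.
    by move=> w B mB; rewrite conditioning_kernelE.
  pose h (w : Omega) := \int[lambda]_u ((\1_(cube n) u)%:E * g (Y w, u)).
  have mh : measurable_fun setT h.
    apply: (measurable_lebesgue_integral
      (g := fun p => (\1_(cube n) p.2)%:E * g (Y p.1, p.2))).
      apply: emeasurable_funM; first exact: (measurableT_comp m1C).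
      apply: (measurableT_comp mg); apply: measurable_fun_pair => //.
      exact: (measurableT_comp mY measurable_fst).
    by move=> p; rewrite mule_ge0// lee_fin.
  have h0 w : 0 <= h w.
    by apply: integral_ge0 => u _; rewrite mule_ge0// lee_fin.
  rewrite -ge0_integralZl ?inve_ge0//; last by move=> w _; exact: h0.
  rewrite -(intpi (fun w => (lambda (cube n))^-1 * h w)); last 2 first.
  - exact: measurable_funeM.
  - by move=> w; rewrite mule_ge0// inve_ge0.
  apply: eq_integral => w _; rewrite integral_conditioning_kernel//.
    by rewrite integral_indicM.
  exact: measurableT_comp.
(* The set [C - u] as a preimage, which makes it measurable; [AE] relates it to the image in
   [mass_stationary]. *)
pose A (p : (E * M) * Rd) : set Rd := (fun v => v + p.2)%R @^-1` cube n.
have mA p : measurable (A p).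
  rewrite -[X in measurable X]setTI.
  have mp : measurable_fun setT (fun v : Rd => v + p.2)%R.
    exact: measurable_funD_rV.
  exact: mp.
have AE (p : (E * M) * Rd) : A p = [set y - p.2 | y in cube n]%R.
  apply/seteqP; split => [v|_ [y yC <-]]; rewrite /A /preimage/=.
    by exists (v + p.2)%R => //; rewrite addrK.
  by rewrite subrK.
pose xi_ (p : (E * M) * Rd) : {measure set Rd -> \bar R} := p.1.2.
have mxi_ : measurable_fun setT (fun p : (E * M) * Rd => p.1.2).
  exact: (measurableT_comp measurable_snd measurable_fst).
have mkV B : measurable B -> measurable_fun setT (fun p => xi_ p (B `&` A p)).
  move=> mB.
  pose f (q : ((E * M) * Rd) * Rd) : \bar R :=
    (\1_B q.2)%:E * (\1_(cube n) (q.2 + q.1.2)%R)%:E.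
  have mf : measurable_fun setT f.
    apply: emeasurable_funM; apply/measurable_EFinP.
      exact: (measurableT_comp (measurable_indic mB) measurable_snd).
    have mq : measurable_fun setT
        (fun q : ((E * M) * Rd) * Rd => q.2 + q.1.2)%R.
      apply: measurable_funD_rV => //.
      exact: (measurableT_comp measurable_snd measurable_fst).
    exact: (measurableT_comp (measurable_indic mC) mq).
  have f0 q : 0 <= f q by rewrite mule_ge0// lee_fin.
  have := measurable_integral_lfmeasure mxi_ mf f0.
  congr measurable_fun; apply/funext => p.
  rewrite /xi_ -[in RHS](setIT (B `&` A p)) -integral_indic//; last first.
    exact: measurableI.
  by apply: eq_integral => v _; rewrite /f indicI /= EFinM.
pose kV : R.-fker ((E * M) * Rd) ~> Rd := conditioning_kernel mA mkV.
pose gG (p : (E * M) * Rd) := G (shift_pair theta (- p.2) p.1, p.2).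
have mgG : measurable_fun setT gG.
  apply: (measurableT_comp mG); apply: measurable_fun_pair => //.
  by apply: measurable_shift_pair => //; exact: measurable_funN_rV.
have gG0 p : 0 <= gG p by exact: G0.
pose h (q : ((E * M) * Rd) * Rd) :=
  gG (shift_pair theta q.2 q.1.1, (q.2 + q.1.2)%R).
have mh : measurable_fun setT h.
  apply: (measurableT_comp mgG); apply: measurable_fun_pair.
    apply: measurable_shift_pair => //.
    exact: (measurableT_comp measurable_fst measurable_fst).
  apply: measurable_funD_rV => //.
  exact: (measurableT_comp measurable_snd measurable_fst).
have h0 q : 0 <= h q by exact: G0.
(* Shifting by [v] and then by [- (v + u)] is shifting by [- u]: the first argument of [G] no longer
   contains [v]. *)
have hE y u v : h ((y, u), v) = G (shift_pair theta (- u) y, (v + u)%R).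
  by rewrite /h /gG/= -shift_pairD opprD addrAC addNr add0r.
have mVY : measurable_fun setT
    (fun w => (shift_pair theta (V w) (Y' w), (V w + U w)%R)).
  apply: measurable_fun_pair; first exact: measurable_shift_pair.
  exact: measurable_funD_rV.
have eqg : \int[P']_w h ((Y' w, U w), V w) = \int[P']_w gG (Y' w, U w).
  rewrite -(integral_image_measure P' mYU)//.
  rewrite -[LHS](integral_image_measure P' mVY)//.
  by apply: eq_measure_integral => B mB _; exact: eqd.
pose Phi (p : (E * M) * Rd) := \int[kV p]_v h (p, v).
have mPhi : measurable_fun setT Phi.
  exact: measurable_fun_integral_finite_kernel.
have Phi0 p : 0 <= Phi p by exact: integral_ge0.
have : \int[P']_w Phi (Y' w, U w) = \int[P']_w gG (Y' w, U w).
  rewrite -eqg (cond_distribution_integral mYU mV (k := kV) sfYU _ condV)//.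
  by move=> w B mB; rewrite conditioning_kernelE// AE.
rewrite (intU Phi mPhi Phi0) (intU gG mgG gG0).
(* Both sides carry the factor [1 / lambda (cube n)] of the uniform law of U; it cancels because the
   volume is positive and finite. *)
move=> /(muleVI (@lebesgue_cube_gt0 R d n) (@lebesgue_cube_lty R d n)) gPhi.
transitivity (\int[P0]_w \int[lambda]_u ((\1_(cube n) u)%:E * gG (Y w, u))).
  apply: eq_integral => w _; apply: eq_integral => u _.
  rewrite /gG/= indicE; case: (boolP (u \in cube n)) => [_|/negP uC].
    by rewrite mul1e.
  by rewrite mul0e Gn// => /mem_set.
rewrite -gPhi; apply: eq_integral => w _; apply: eq_integral => u _.
congr (_ * _); rewrite /Phi integral_conditioning_kernel//; last first.
  exact: measurableT_comp.
congr (_^-1 * _).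
  by rewrite AE -shift_funE.
rewrite integral_indicM integral_shift_measure//; last first.
  exact: measurableT_comp.
(* For [v] outside [C - u] the time [v + u] is outside the cube and [G] is 0, so the restriction
   disappears. *)
apply: eq_integral => v _; rewrite hE opprK indicE.
case: (boolP (v \in _)) => [_|/negP vA]; first by rewrite mul1e.
by rewrite mul0e Gn// => ?; apply: vA; exact: mem_set.
Qed.

Definition campbell (f : (E * M) * (Rd * Rd) -> \bar R) :=
  \int[P0]_w \int[lambda]_t \int[(Z w t).2]_s f (Z w t, (t, s)).

Let measurable_campbell_inner (f : (E * M) * (Rd * Rd) -> \bar R) :
  measurable_fun setT f -> (forall x, 0 <= f x) ->
  measurable_fun setT
    (fun p : Omega * Rd => \int[(Z p.1 p.2).2]_s f (Z p.1 p.2, (p.2, s))).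
Proof.
move=> mf f0.
have mz := measurableT_comp measurable_snd measurable_translates.
apply: (measurable_integral_lfmeasure mz
  (f := fun q => f (Z q.1.1 q.1.2, (q.1.2, q.2)))) => //.
apply: (measurableT_comp mf); apply: measurable_fun_pair.
  exact: (measurableT_comp measurable_translates measurable_fst).
apply: measurable_fun_pair => //.
exact: (measurableT_comp measurable_snd measurable_fst).
Qed.

Let measurable_campbell_section (f : (E * M) * (Rd * Rd) -> \bar R) z t :
  measurable_fun setT f -> measurable_fun setT (fun s => f (z, (t, s))).
Proof.
by move=> mf; apply: (measurableT_comp mf); apply: measurable_fun_pair.
Qed.

Lemma cvg_campbell (f : nat -> (E * M) * (Rd * Rd) -> \bar R) :
  (forall n, measurable_fun setT (f n)) -> (forall n x, 0 <= f n x) ->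
  (forall x, nondecreasing_seq (f ^~ x)) ->
  campbell (fun x => limn (f ^~ x)) = limn (fun n => campbell (f n)).
Proof.
move=> mf f0 ndf; rewrite /campbell.
have mg n := measurable_campbell_inner (mf n) (f0 n).
have g0 n (p : Omega * Rd) : 0 <= \int[(Z p.1 p.2).2]_s f n (Z p.1 p.2, (p.2, s)).
  by apply: integral_ge0 => s _; exact: f0.
have ndg (p : Omega * Rd) : nondecreasing_seq
    (fun n => \int[(Z p.1 p.2).2]_s f n (Z p.1 p.2, (p.2, s))).
  move=> m n mn; apply: ge0_le_integral => //.
  - exact: measurable_campbell_section.
  - exact: measurable_campbell_section.
  - by move=> s _; exact: ndf.
have mgw n w : measurable_fun setT
    (fun t : Rd => \int[(Z w t).2]_s f n (Z w t, (t, s))).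
  exact: (measurable_fun_pair2 w (mg n)).
rewrite -monotone_convergence//; last 3 first.
- by move=> n; exact: (measurable_lebesgue_integral (mg n)).
- by move=> n w _; apply: integral_ge0 => t _; exact: (g0 n (w, t)).
- move=> w _ m n mn; apply: ge0_le_integral => //.
  + by move=> t _; exact: (g0 m (w, t)).
  + by move=> t _; exact: (ndg (w, t)).
apply: eq_integral => w _; rewrite -monotone_convergence//; last 2 first.
- by move=> n t _; exact: (g0 n (w, t)).
- by move=> t _; exact: (ndg (w, t)).
apply: eq_integral => t _; rewrite -monotone_convergence//.
by move=> n; exact: measurable_campbell_section.
Qed.

Let measurable_swap (f : (E * M) * (Rd * Rd) -> \bar R) :
  measurable_fun setT f -> measurable_fun setT (fun x => f (x.1, (x.2.2, x.2.1))).
Proof.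
move=> mf; apply: (measurableT_comp mf); apply: measurable_fun_pair => //.
apply: measurable_fun_pair.
  exact: (measurableT_comp measurable_snd measurable_snd).
exact: (measurableT_comp measurable_fst measurable_snd).
Qed.

(** Resampling is applied to [G], the integral of [f] over s. Afterwards r and s are integrated
    against the same measure, with a factor free of both. *)
Let campbell_cube n (f : (E * M) * (Rd * Rd) -> \bar R) :
  measurable_fun setT f -> (forall x, 0 <= f x) ->
  (forall z t s, ~ cube n t \/ ~ cube n s -> f (z, (t, s)) = 0) ->
  campbell f = \int[P0]_w \int[lambda]_t ((\1_(cube n) t)%:E *
    (((Z w t).2 (cube n))^-1 * \int[(Z w t).2]_r \int[(Z w t).2]_s
       f (Z w t, (r, s)))).
Proof.
move=> mf f0 fn.
pose G (p : (E * M) * Rd) := \int[p.1.2]_s f (p.1, (p.2, s)).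
have mG : measurable_fun setT G.
  have mz : measurable_fun setT (fun p : (E * M) * Rd => p.1.2).
    exact: (measurableT_comp measurable_snd measurable_fst).
  apply: (measurable_integral_lfmeasure mz
    (f := fun q => f (q.1.1, (q.1.2, q.2)))) => //.
  apply: (measurableT_comp mf); apply: measurable_fun_pair.
    exact: (measurableT_comp measurable_fst measurable_fst).
  apply: measurable_fun_pair => //.
  exact: (measurableT_comp measurable_snd measurable_fst).
have G0 p : 0 <= G p by apply: integral_ge0 => s _; exact: f0.
have Gn z t : ~ cube n t -> G (z, t) = 0.
  by move=> tn; apply: integral0_eq => s _; apply: fn; left.
exact: (mass_stationary_cube mG G0 Gn).
Qed.

(* On the event that t and s lie in a cube, mass_stationary_cube lets one resample
   t from the normalized restriction to the cube of the very measure that s is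
   integrated against; t and s then become exchangeable. *)
Lemma campbell_swap (f : (E * M) * (Rd * Rd) -> \bar R) :
  measurable_fun setT f -> (forall x, 0 <= f x) ->
  campbell f = campbell (fun x => f (x.1, (x.2.2, x.2.1))).
Proof.
move=> mf f0.
(* The truncation is itself symmetric in t and s, so [campbell_cube] applies to the truncated
   function and to its swap; it increases to 1. *)
pose c n (x : (E * M) * (Rd * Rd)) : \bar R :=
  (\1_(cube n) x.2.1)%:E * (\1_(cube n) x.2.2)%:E.
have mc n : measurable_fun setT (c n).
  have mC : measurable_fun setT (\1_(cube n) : Rd -> R).
    exact: measurable_indic (@measurable_cube R d n).
  have m1 : measurable_fun setT (fun x : (E * M) * (Rd * Rd) => x.2.1).
    exact: (measurableT_comp measurable_fst measurable_snd).
  have m2 : measurable_fun setT (fun x : (E * M) * (Rd * Rd) => x.2.2).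
    exact: (measurableT_comp measurable_snd measurable_snd).
  apply: emeasurable_funM; apply/measurable_EFinP.
    exact: (measurableT_comp mC m1).
  exact: (measurableT_comp mC m2).
have c0 n x : 0 <= c n x by rewrite mule_ge0// lee_fin.
have ndc x : nondecreasing_seq (c ^~ x).
  move=> m n mn; rewrite /c -!EFinM lee_fin; apply: ler_pM => //;
    rewrite !indicE ler_nat; case: (boolP (_ \in cube m)) => // /set_mem xm;
    by rewrite mem_set//; exact: (nondecreasing_cube mn).
have limc x : limn (c ^~ x) = 1.
  apply/cvg_lim => //; apply: cvg_near_cst.
  have [m _ xm] : (\bigcup_n cube n) x.2.1 by rewrite bigcup_cube.
  have [m' _ xm'] : (\bigcup_n cube n) x.2.2 by rewrite bigcup_cube.
  near=> n; rewrite /c !indicE !mem_set ?mul1e//.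
    apply: (nondecreasing_cube _ xm'); near: n; exact: nbhs_infty_ge.
  by apply: (nondecreasing_cube _ xm); near: n; exact: nbhs_infty_ge.
pose g n x := c n x * f x.
have mg n : measurable_fun setT (g n) by exact: emeasurable_funM.
have g0 n x : 0 <= g n x by rewrite mule_ge0.
have ndg x : nondecreasing_seq (g ^~ x).
  by move=> m n mn; rewrite /g lee_wpmul2r// ndc.
have limg : (fun x => limn (g ^~ x)) = f.
  apply/funext => x; rewrite /g; under eq_fun do rewrite muleC.
  by rewrite ge0_nd_limeMl// ?limc ?mule1//; exact: ndc.
pose sw (x : (E * M) * (Rd * Rd)) := (x.1, (x.2.2, x.2.1)).
pose gs n x := g n (sw x).
have mgs n : measurable_fun setT (gs n) by exact: measurable_swap.
have limgs : (fun x => limn (gs ^~ x)) = (fun x => f (sw x)).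
  by apply/funext => x; rewrite -[in RHS]limg.
suff swE n : campbell (g n) = campbell (gs n).
  have e1 := cvg_campbell mg g0 ndg; rewrite limg in e1.
  have e2 := cvg_campbell mgs (fun n x => g0 n (sw x)) (fun x => ndg (sw x)).
  rewrite limgs in e2.
  have e3 := congr1 (fun u : (\bar R)^nat => limn u) (funext swE).
  exact: (etrans e1 (etrans e3 (esym e2))).
have gn z t s : ~ cube n t \/ ~ cube n s -> g n (z, (t, s)) = 0.
  move=> ts; rewrite /g /c/= !indicE; case: ts => nC.
    by rewrite (memNset nC) !mul0e.
  by rewrite (memNset nC) mule0 mul0e.
(* Locally finite measures are sigma-finite, so the double integral over r and s can be
   exchanged. *)
have tonelli w t : \int[(Z w t).2]_r \int[(Z w t).2]_s g n (Z w t, (r, s)) =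
    \int[(Z w t).2]_r \int[(Z w t).2]_s gs n (Z w t, (r, s)).
  have sf : sigma_finite setT (Z w t).2 by exact: lfmeasure_sigma_finite.
  have mgz : measurable_fun setT (fun p => g n (Z w t, p)).
    exact: (measurable_fun_pair2 (Z w t) (mg n)).
  exact: (sigma_finite_tonelli sf sf mgz (fun p => g0 n (Z w t, p))).
rewrite (campbell_cube (mg n) (g0 n) (gn)) (campbell_cube (n := n) (mgs n)).
- by apply: eq_integral => w _; apply: eq_integral => t _; rewrite tonelli.
- by move=> x; exact: g0.
- by move=> z t s ts; apply: gn; case: ts; [right|left].
Unshelve. all: by end_near. Qed.

End stationarity.

End flow.

(** * The randomized shift *)

Lemma counting_eq0 (T : choiceType) (R : realType) (A : set T) :
  counting A = 0 :> \bar R -> A = set0.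
Proof.
rewrite /counting; case: asboolP => // finA [] /eqP.
by rewrite pnatr_eq0 cardfs_eq0 => /eqP/fset_set_set0; exact.
Qed.

Lemma cond_counting_set1 (T : choiceType) (R : realType) (A : set T) (x : T) :
  cond_measure (@counting T R) A [set x] = (\1_A x)%:E / counting A.
Proof.
rewrite /cond_measure; congr (_ / _); rewrite indicE /counting.
have [Ax|nAx] := pselect (A x).
  rewrite mem_set// (_ : _ `&` _ = [set x]).
    by rewrite asboolT// fset_set1 cardfs1.
  by apply/seteqP; split => [y []//|y ->].
rewrite memNset// (_ : _ `&` _ = set0).
  by rewrite asboolT// fset_set0.
by rewrite -subset0 => y [-> ].
Qed.

Lemma eseries_only {R : realType} (m : nat) (a : nat -> \bar R) :
  (forall n, n != m -> a n = 0) -> \sum_(n <oo) a n = a m.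
Proof.
move=> a0; apply/cvg_lim => //; apply: cvg_near_cst.
near=> n; have mn : (m < n)%N by near: n; exact: nbhs_infty_gt.
rewrite big_mkord (bigD1 (Ordinal mn))//= big1 ?adde0// => i im.
by apply: a0; apply: contra im => /eqP im; exact/eqP/val_inj.
Unshelve. all: by end_near. Qed.

Section construction.
Context {R : realType} {d : nat} {dE : measure_display} {E : measurableType dE}.
Notation Rd := 'rV[R]_d.
Notation M := (lfmeasure R d).
Notation lambda := (@lebesgue_rV R d).
Hypothesis d_gt0 : (0 < d)%N.
Variable theta : Rd -> E -> E.
Hypothesis theta0 : forall x, theta 0 x = x.
Hypothesis thetaD : forall s t x, theta (s + t) x = theta s (theta t x).
Hypothesis measurable_theta :
  measurable_fun setT (fun p : Rd * E => theta p.1 p.2).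
Context {dO : measure_display} {Omega : measurableType dO}.
Variables (P0 : {measure set Omega -> \bar R}).
Variables (X0 : Omega -> E) (xi0 : Omega -> M).
Hypotheses (mX0 : measurable_fun setT X0) (mxi0 : measurable_fun setT xi0).
Hypothesis sigma_finite0 :
  sigma_finite setT (pushforward P0 (fun w => (X0 w, xi0 w))).
Hypothesis support0 : {ae P0, forall w, msupport (xi0 w) 0%R}.
Variable T : Omega -> Rd.
Hypothesis mT : measurable_fun setT T.
Hypothesis T_cube : forall w, unit_cube (T w).
Hypothesis T_uniform : cond_distribution P0 (fun w => (X0 w, xi0 w)) T
  (fun _ => cond_measure lambda unit_cube).
Variable S : Omega -> Rd.
Hypothesis mS : measurable_fun setT S.
Hypothesis S_cell :
  {ae P0, forall w, zero_cell (shift_measure (- T w) (xi0 w)) (S w)}.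
Hypothesis S_uniform : cond_distribution P0 (fun w => ((X0 w, xi0 w), T w)) S
  (fun w => cond_measure counting (zero_cell (shift_measure (- T w) (xi0 w)))).

Notation Y w := (X0 w, xi0 w).
Notation W w := ((X0 w, xi0 w), T w).
Notation Z w t := (shift_pair theta (- t) (X0 w, xi0 w)).
Notation zT w := (shift_measure (- T w) (xi0 w)).

Let mY : measurable_fun setT (fun w => Y w).
Proof. exact: measurable_fun_pair. Qed.

Let mW : measurable_fun setT (fun w => W w).
Proof. exact: measurable_fun_pair. Qed.

Let shiftP (p : (E * M) * Rd) : M := shift_measure (- p.2) p.1.2.

Let m_shiftP : measurable_fun setT shiftP.
Proof.
apply: measurable_shift_measure; first exact: measurable_funN_rV.
exact: (measurableT_comp measurable_snd measurable_fst).
Qed.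

Lemma ae_xi0_neq0 : {ae P0, forall w, xi0 w setT != 0}.
Proof.
apply: filterS support0 => w /(_ setT openT I).
by move=> xi_gt0; rewrite gt_eqF.
Qed.

(** T already lies in the half-open cube, so only the faces with a zero coordinate have to be
    excluded, and these are null for the uniform law. *)
Lemma ae_T_interior : {ae P0, forall w, forall j, (0 < T w ord0 j < 1)%R}.
Proof.
pose N : set Rd := unit_cube `&` [set x | exists j, x ord0 j = 0%R].
have mN : measurable N.
  apply: measurableI; first exact: measurable_unit_cube.
  apply: measurable_countable_exists => j.
  rewrite -[X in measurable X]setTI.
  exact: (measurable_coord j measurableT (measurable_set1 0%R)).
exists (T @^-1` N); split.
- by rewrite -[X in measurable X]setTI; exact: mT.
- rewrite -[LHS](_ : P0 ((fun w => Y w) @^-1` setT `&` T @^-1` N) = _); last first.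
    by rewrite preimage_setT setTI.
  rewrite (T_uniform mN).2//; apply: integral0_eq => w _.
  rewrite /cond_measure lebesgue_rV_negligible_coord0 ?mul0e//.
    by apply: measurableI => //; exact: measurable_unit_cube.
  by move=> x [[]].
- move=> w /= /existsNP[j Tj]; split; first exact: T_cube.
  exists j; have /andP[T0 T1] := T_cube w j.
  apply/eqP; rewrite eq_le T0 andbT leNgt; apply/negP => T_gt0.
  by apply: Tj; rewrite T_gt0.
Qed.

(** The support condition concerns open neighbourhoods of 0; for T in the interior, the unit cube
    moved by [- T] contains one. *)
Lemma ae_cube_process0 : {ae P0, forall w, cube_process (zT w) 0%R}.
Proof.
move: ae_T_interior support0; apply: filterS2 => w Tw xi_supp.
rewrite cube_processE lattice0 shift_measure0.
(* The sup-norm distance from T to the faces of the cube, capped at 1. *)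
pose eps := (\big[Order.min/1]_(j < d) Order.min (T w ord0 j) (1 - T w ord0 j))%R.
have eps0 : (0 < eps)%R.
  apply/bigmin_gtP; split => // j _.
  by rewrite lt_min subr_gt0; exact: Tw.
have epsT j : (eps <= Order.min (T w ord0 j) (1 - T w ord0 j))%R.
  exact: bigmin_le_cond.
pose U : set Rd := [set x | (`|x| < eps)%R].
have oU : open U.
  rewrite (_ : U = (fun x : Rd => `|x|%R) @^-1` [set r | (r < eps)%R])//.
  move: (@norm_continuous R Rd) => /continuousP; apply; exact: open_lt.
have U0 : U 0%R by rewrite /U/= normr0.
apply: (lt_le_trans (xi_supp U oU U0)).
rewrite /= /shift_fun /pushforward; apply: le_measure; rewrite ?inE.
- exact: open_measurable_rV.
- rewrite -[X in measurable X]setTI; apply: measurable_subr => //.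
  exact: measurable_unit_cube.
- move=> x Ux j; have := le_lt_trans (le_norm_rV x j) Ux.
  have := epsT j; rewrite le_min => /andP[eT e1] xe.
  rewrite opprK mxE; move: xe; rewrite ltr_norml => /andP[xl xr].
  apply/andP; split.
    by rewrite -lerBlDr sub0r (le_trans _ (ltW xl))// lerN2.
  by rewrite -ltrBrDr (lt_le_trans xr).
Qed.

Lemma measurable_counting_cell : measurable_fun setT
  (fun p => counting (zero_cell (shiftP p)) : \bar R).
Proof.
exact: (measurableT_comp (measurable_fun_counting_zero_cell d_gt0) m_shiftP).
Qed.

(* On an infinite cell the kernel in S_uniform has mass +oo / +oo = 0, so S_uniform
   alone forces the cell to be finite almost everywhere. *)
Lemma ae_finite_cell :
  {ae P0, forall w, (counting (zero_cell (zT w)) < +oo :> \bar R)}.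
Proof.
pose A : set ((E * M) * Rd) :=
  [set p | counting (zero_cell (shiftP p)) = +oo :> \bar R].
have mA : measurable A.
  rewrite /A -[X in measurable X]setTI.
  rewrite (_ : mkset _ = (fun p => counting (zero_cell (shiftP p)) : \bar R)
    @^-1` [set +oo])//.
  exact: (measurable_counting_cell measurableT).
exists ((fun w => W w) @^-1` A); split.
- by rewrite -[X in measurable X]setTI; exact: mW.
- rewrite -[LHS](_ : P0 ((fun w => W w) @^-1` A `&` S @^-1` setT) = _); last first.
    by rewrite preimage_setT setIT.
  rewrite (S_uniform measurableT).2//; apply: integral0_eq => w Aw.
  by rewrite /cond_measure setTI [counting _]Aw invey mule0.
- by move=> w /= /negP; rewrite -leNgt leye_eq => /eqP.
Qed.

Lemma integral_T_uniform (h : (E * M) * Rd -> \bar R) :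
  measurable_fun setT h -> (forall p, 0 <= h p) ->
  \int[P0]_w h (W w) =
  \int[P0]_w \int[lambda]_u ((\1_unit_cube u)%:E * h (Y w, u)).
Proof.
move=> mh h0.
have mQ := @measurable_unit_cube R d.
have mk B : measurable B -> measurable_fun [set: E * M]
    (fun=> lambda (B `&` unit_cube)) by move=> mB; exact: measurable_cst.
pose k : R.-fker (E * M) ~> Rd :=
  conditioning_kernel (z := fun=> lambda) (fun=> mQ) mk.
rewrite (cond_distribution_integral mY mT (k := k) sigma_finite0 _ T_uniform)//.
  apply: eq_integral => w _; rewrite integral_conditioning_kernel//.
    rewrite -[X in X^-1]/(lambda unit_cube).
    by rewrite lebesgue_unit_cube inve1 mul1e integral_indicM.
  exact: measurable_fun_pair2.
by move=> w B mB; rewrite conditioning_kernelE.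
Qed.

(** On the event [S = s] the law of [W] has as density the mass of [s] under the uniform law on the
    cell. Fixing [s] reduces that law to its values at singletons. *)
Lemma integral_S_uniform (s : Rd) (h : (E * M) * Rd -> \bar R) :
  measurable_fun setT h -> (forall p, 0 <= h p) ->
  measurable [set mu : M | zero_cell mu s] ->
  \int[P0]_(w in S @^-1` [set s]) h (W w) =
  \int[P0]_w (cond_measure counting (zero_cell (zT w)) [set s] * h (W w)).
Proof.
move=> mh h0 ms.
have mSs : measurable (S @^-1` [set s]).
  rewrite -[X in measurable X]setTI; apply: mS => //.
  exact: measurable_set1_rV.
pose g w := cond_measure (@counting Rd R) (zero_cell (zT w)) [set s].
have mg : measurable_fun setT g.
  rewrite (_ : g = (fun w => (\1_[set mu : M | zero_cell mu s] (zT w))%:E /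
      counting (zero_cell (zT w)))).
    have mz : measurable_fun setT (fun w => zT w).
      exact: (measurableT_comp m_shiftP mW).
    apply: emeasurable_funM.
      by apply/measurable_EFinP; exact: (measurableT_comp (measurable_indic ms) mz).
    apply: measurable_funV; exact: (measurableT_comp measurable_counting_cell mW).
  by apply/funext => w; rewrite /g cond_counting_set1.
have g0 w : 0 <= g w.
  by rewrite /g /cond_measure mule_ge0 ?inve_ge0//;
    exact: (measure_ge0 (@counting Rd R)).
pose nu := image_measure (mrestr P0 mSs) mW.
have nuE A : measurable A -> nu A = \int[P0]_(w in (fun w => W w) @^-1` A) g w.
  move=> mA; rewrite /nu /image_measure/= /pushforward /mrestr.
  by rewrite -(S_uniform (measurable_set1_rV s)).2.
rewrite -(integral_density mW mg g0 nuE)// integral_image_measure//.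
rewrite integral_mrestr//; exact: (measurableT_comp mh mW).
Qed.

(** * The change of measure and the joint law of the shifted pair and T *)

Variable P : {measure set Omega -> \bar R}.
Hypothesis P_density : forall A, measurable A ->
  P A = \int[P0]_(w in A)
    (counting (zero_cell (zT w)) / shift_measure (- T w) (xi0 w) unit_cube).

Notation ZS w := (shift_pair theta (S w) (Z w (T w))).

Let mZ : measurable_fun setT (fun p : Omega * Rd => Z p.1 p.2).
Proof. exact: measurable_translates. Qed.

Lemma measurable_ZS : measurable_fun setT (fun w => ZS w).
Proof.
have mZT : measurable_fun setT (fun w => Z w (T w)).
  by apply: measurable_shift_pair => //; exact: measurable_funN_rV.
exact: measurable_shift_pair.
Qed.

Let density (p : (E * M) * Rd) : \bar R :=
  counting (zero_cell (shiftP p)) / shiftP p unit_cube.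

Let m_density : measurable_fun setT density.
Proof.
apply: emeasurable_funM; first exact: measurable_counting_cell.
apply: measurable_funV.
exact: (measurableT_comp (measurable_lfmeasure_eval measurable_unit_cube) m_shiftP).
Qed.

Let density_ge0 p : 0 <= density p.
Proof.
by rewrite mule_ge0 ?inve_ge0//; exact: (measure_ge0 (@counting Rd R)).
Qed.

Lemma integral_P (f : Omega -> \bar R) :
  measurable_fun setT f -> (forall w, 0 <= f w) ->
  \int[P]_w f w = \int[P0]_w (density (W w) * f w).
Proof.
move=> mf f0; apply: (integral_density (W := id)) => //.
exact: (measurableT_comp m_density mW).
Qed.

(* The integrand after averaging over the values of S, with s in the role of S:
   by zero_cellE, s belongs to the cell of 0 exactly when - s is the centre of 0
   after shifting by s. *)
Let lattice_weight (s : Rd) (F : (E * M) * Rd -> \bar R) (p : (E * M) * Rd) :=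
  (\1_[set mu : M | voronoi_center0 mu = - s]%R
    (shift_measure s (shiftP p)))%:E / shiftP p unit_cube *
  F (shift_pair theta s (shift_pair theta (- p.2) p.1), p.2).

Let m_center_eq (s : Rd) : measurable [set mu : M | voronoi_center0 mu = - s]%R.
Proof.
rewrite -[X in measurable X]setTI.
exact: (measurable_voronoi_center0 measurableT (measurable_set1_rV (- s)%R)).
Qed.

Let m_shiftF (s : Rd) (F : (E * M) * Rd -> \bar R) : measurable_fun setT F ->
  measurable_fun setT (fun p : (E * M) * Rd =>
    F (shift_pair theta s (shift_pair theta (- p.2) p.1), p.2)).
Proof.
move=> mF; apply: (measurableT_comp mF); apply: measurable_fun_pair => //.
apply: measurable_shift_pair => //.
by apply: measurable_shift_pair => //; exact: measurable_funN_rV.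
Qed.

Let m_lattice_weight s F : measurable_fun setT F ->
  measurable_fun setT (lattice_weight s F).
Proof.
move=> mF; apply: emeasurable_funM; last exact: m_shiftF.
have msP : measurable_fun setT (fun p => shift_measure s (shiftP p)).
  exact: measurable_shift_measure.
apply: emeasurable_funM.
  apply/measurable_EFinP.
  exact: (measurableT_comp (measurable_indic (m_center_eq s)) msP).
apply: measurable_funV.
exact: (measurableT_comp (measurable_lfmeasure_eval measurable_unit_cube) m_shiftP).
Qed.

Let lattice_weight_ge0 s F p : (forall q, 0 <= F q) -> 0 <= lattice_weight s F p.
Proof.
by move=> F0; rewrite /lattice_weight !mule_ge0// ?inve_ge0// lee_fin.
Qed.

(** The number of points in the density cancels the one in the uniform law of S. This needs it
    finite, which holds almost everywhere, and nonzero, which holds as soon as [s] lies in the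
    cell. *)
Let integral_P_lattice (s : 'rV[int]_d) (F : (E * M) * Rd -> \bar R) :
  measurable_fun setT F -> (forall p, 0 <= F p) ->
  \int[P0]_(w in S @^-1` [set lattice R s]) (density (W w) * F (ZS w, T w)) =
  \int[P0]_w lattice_weight (lattice R s) F (W w).
Proof.
move=> mF F0.
pose h p := density p *
  F (shift_pair theta (lattice R s) (shift_pair theta (- p.2) p.1), p.2).
have mh : measurable_fun setT h by apply: emeasurable_funM => //; exact: m_shiftF.
have h0 p : 0 <= h p by rewrite mule_ge0.
(* On the event [S = s] the integrand is a function of [W], to which the conditional law of S
   applies. *)
transitivity (\int[P0]_(w in S @^-1` [set lattice R s]) h (W w)).
  by apply: eq_integral => w /set_mem/= Sw; rewrite /h Sw.
rewrite integral_S_uniform//; last exact: measurable_zero_cell.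
pose k (p : (E * M) * Rd) : \bar R :=
  (\1_[set mu : M | zero_cell mu (lattice R s)] (shiftP p))%:E /
  counting (zero_cell (shiftP p)).
have mk : measurable_fun setT k.
  apply: emeasurable_funM.
    apply/measurable_EFinP.
    exact: (measurableT_comp (measurable_indic (measurable_zero_cell s)) m_shiftP).
  apply: measurable_funV; exact: measurable_counting_cell.
have k0 p : 0 <= k p.
  by rewrite mule_ge0 ?lee_fin ?inve_ge0//; exact: (measure_ge0 (@counting Rd R)).
have kE w : cond_measure (@counting Rd R) (zero_cell (zT w)) [set lattice R s] =
    k (W w).
  by rewrite cond_counting_set1.
under eq_integral => w _ do rewrite kE.
apply: ge0_ae_eq_integral => //.
- apply: (measurableT_comp (f := fun p => k p * h p) _ mW).
  exact: emeasurable_funM.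
- exact: (measurableT_comp (m_lattice_weight _ mF) mW).
- by move=> w _; rewrite mule_ge0.
- by move=> w _; exact: lattice_weight_ge0.
- move: ae_cube_process0 ae_finite_cell; apply: filterS2 => w N0 fin _.
  rewrite /h /lattice_weight muleA; congr (_ * _).
  rewrite /k /density !indicE.
  have -> : (shift_measure (lattice R s) (shiftP (W w)) \in
      [set mu : M | voronoi_center0 mu = - lattice R s]%R) =
    (shiftP (W w) \in [set mu : M | zero_cell mu (lattice R s)]).
    by apply/idP/idP => /set_mem/(zero_cellE _ N0) ?; apply/mem_set.
  have [zs|zs] := boolP (shiftP (W w) \in _); last by rewrite !mul0e.
  rewrite !mul1e muleA -[X in X * _]muleC divee ?mul1e//.
    rewrite ge0_fin_numE//; exact: (measure_ge0 (@counting Rd R)).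
  apply/eqP => /counting_eq0 z0; move: zs => /set_mem/=.
  by rewrite /shiftP/= z0.
Qed.

Definition weighted (F : (E * M) * Rd -> \bar R) (p : (E * M) * Rd) : \bar R :=
  voronoi_weight p.1.2 p.2 * F (p.1, (p.2 - voronoi_center0 p.1.2)%R).

Let m_zeta : measurable_fun setT (fun p : (E * M) * Rd => p.1.2).
Proof. exact: (measurableT_comp measurable_snd measurable_fst). Qed.

Lemma measurable_weighted F : measurable_fun setT F ->
  measurable_fun setT (weighted F).
Proof.
move=> mF; apply: emeasurable_funM; first exact: measurable_voronoi_weight.
apply: (measurableT_comp mF); apply: measurable_fun_pair => //.
apply: measurable_funD_rV => //; apply: measurable_funN_rV.
exact: (measurableT_comp measurable_voronoi_center0 m_zeta).
Qed.

Lemma weighted_ge0 F p : (forall q, 0 <= F q) -> 0 <= weighted F p.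
Proof. by move=> F0; rewrite mule_ge0 ?voronoi_weight_ge0. Qed.

(** Each lattice value of S contributes a Lebesgue integral over the unit cube, the law of T. A
    translation carries it to the cube at the centre, and since every t has exactly one centre, the
    sum over the lattice recovers the integral over all t. *)
Lemma integral_construction F : measurable_fun setT F -> (forall p, 0 <= F p) ->
  \int[P]_w F (ZS w, T w) = \int[P0]_w \int[lambda]_t weighted F (Z w t, t).
Proof.
move=> mF F0; have [e [injE eP eS]] := lattice_enum (R := R) d_gt0.
pose q w := density (W w) * F (ZS w, T w).
have mq : measurable_fun setT q.
  apply: emeasurable_funM; first exact: (measurableT_comp m_density mW).
  apply: (measurableT_comp mF); apply: measurable_fun_pair => //.
  exact: measurable_ZS.
have q0 w : 0 <= q w by rewrite mule_ge0.
pose D n := S @^-1` [set e n].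
have mD n : measurable (D n).
  rewrite -[X in measurable X]setTI; apply: mS => //.
  exact: measurable_set1_rV.
have mUD : measurable (\bigcup_n D n) by exact: bigcup_measurable.
have tD : trivIset setT D.
  apply/trivIsetP => m n _ _ mn; rewrite -subset0 => w [Dm Dn].
  by move/eqP: mn; apply; apply: injE; exact: (etrans (esym Dm) Dn).
rewrite integral_P//; last first.
  apply: (measurableT_comp mF); apply: measurable_fun_pair => //.
  exact: measurable_ZS.
transitivity (\int[P0]_(w in \bigcup_n D n) q w).
  rewrite [RHS]integral_mkcond; apply: ge0_ae_eq_integral => //.
  - by apply/(measurable_restrictT _ mUD); exact: measurable_funTS.
  - by move=> w _; exact: q0.
  - by move=> w _; rewrite patchE; case: ifPn.
  - apply: filterS S_cell => w /zero_cell_lattice[s Ss] _.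
    rewrite patchE mem_set//; have [n en] := eS s.
    by exists n => //; exact: (etrans Ss (esym en)).
rewrite ge0_integral_bigcup//; last exact: measurable_funTS.
pose G n (p : (E * M) * Rd) : \bar R :=
  (\1_[set mu : M | voronoi_center0 mu = - e n]%R p.1.2)%:E * weighted F p.
have mG n : measurable_fun setT (G n).
  apply: emeasurable_funM; last exact: measurable_weighted.
  apply/measurable_EFinP.
  exact: (measurableT_comp (measurable_indic (m_center_eq (e n))) m_zeta).
have G0 n p : 0 <= G n p.
  by rewrite mule_ge0 ?lee_fin//; exact: weighted_ge0.
have mZt : measurable_fun setT (fun p : Omega * Rd => (Z p.1 p.2, p.2)).
  exact: measurable_fun_pair.
have mGZ n := measurableT_comp (mG n) mZt.
(* Splits by the centre: exactly one [n] has [e n] equal to minus the centre, also when the centre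
   is the default. *)
have -> : \int[P0]_w \int[lambda]_t weighted F (Z w t, t) =
    \sum_(n <oo) \int[P0]_w \int[lambda]_t G n (Z w t, t).
  rewrite -integral_nneseries//; last 2 first.
  - move=> n; exact: (measurable_lebesgue_integral (mGZ n)
      (fun p => G0 n (Z p.1 p.2, p.2))).
  - by move=> n w _; apply: integral_ge0 => t _; exact: G0.
  apply: eq_integral => w _; rewrite -integral_nneseries//; last first.
    by move=> n; exact: (measurable_fun_pair2 w (mGZ n)).
  apply: eq_integral => t _.
  have [m em] : exists m, e m = (- voronoi_center0 (Z w t).2)%R.
    by rewrite /voronoi_center0 -latticeN.
  have cm : voronoi_center0 (Z w t).2 = (- e m)%R by rewrite em opprK.
  rewrite (eseries_only (m := m)).
    by rewrite /G indicE mem_set ?mul1e.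
  move=> n nm; rewrite /G indicE memNset ?mul0e//= cm => /oppr_inj/injE mn.
  by rewrite mn eqxx in nm.
apply: eq_eseriesr => n _; have [s es] := eP n.
transitivity (\int[P0]_w lattice_weight (e n) F (W w)).
  by rewrite /D es; exact: (integral_P_lattice s mF F0).
rewrite (integral_T_uniform (m_lattice_weight (e n) mF)); last first.
  by move=> p; exact: lattice_weight_ge0.
apply: eq_integral => w _.
(* The value of T is written as [t + e n]. Shifting by [- (t + e n)] and then by [e n] gives [z_t],
   and where the centre c is [- e n] the value of T is [t - c]. *)
rewrite -(integral_lebesgue_rV_translate (e n)); last 2 first.
- apply: emeasurable_funM.
    by apply/measurable_EFinP; apply: measurable_indic; exact: measurable_unit_cube.
  exact: (measurable_fun_pair2 (Y w) (m_lattice_weight (e n) mF)).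
- by move=> u; rewrite mule_ge0 ?lee_fin//; exact: lattice_weight_ge0.
apply: eq_integral => t _.
have se : (e n - (t + e n) = - t)%R by rewrite opprD addrCA subrr addr0.
have E2 : shift_measure (e n) (shiftP (Y w, (t + e n)%R)) = (Z w t).2.
  by rewrite /shiftP -shift_measureD se.
have E1 : shiftP (Y w, (t + e n)%R) = shift_measure (- e n) (Z w t).2.
  by rewrite -E2 -shift_measureD addNr shift_measure0.
have E3 : shift_pair theta (e n) (Z w (t + e n)%R) = Z w t.
  by rewrite -shift_pairD// se.
move: (Z w t) E1 E2 E3 => z E1 E2 E3.
rewrite /G /lattice_weight E2 E1 E3 !indicE/=.
have [cn|cn] := pselect (voronoi_center0 z.2 = - e n)%R; last first.
  by rewrite (@memNset _ [set mu : M | voronoi_center0 mu = - e n]%R z.2 cn)/=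
    !mul0e mule0.
rewrite (@mem_set _ [set mu : M | voronoi_center0 mu = - e n]%R z.2 cn).
rewrite !mul1e /weighted /voronoi_weight /center_measure/= indicE.
by rewrite cn opprK muleA.
Qed.

(** * Palm property, stationarity, conditional law of T, sigma-finiteness *)

Hypothesis mass_stationary0 : mass_stationary theta P0 X0 xi0.

Lemma ae_P0_P (Q : Omega -> Prop) :
  {ae P0, forall w, Q w} -> {ae P, forall w, Q w}.
Proof.
move=> [N [mN N0 QN]]; exists N; split => //.
rewrite P_density//; apply: null_set_integral => //.
by apply: measurable_funTS; exact: (measurableT_comp m_density mW).
Qed.

Lemma shift_measureT (t : Rd) (mu : M) : shift_measure t mu setT = mu setT.
Proof. by rewrite /= /shift_fun /pushforward preimage_setT. Qed.

Lemma ae_ZS_neq0 : {ae P, forall w, (ZS w).2 setT != 0}.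
Proof.
apply: ae_P0_P; apply: filterS ae_xi0_neq0 => w.
by rewrite [(ZS w).2]/(shift_measure _ _) !shift_measureT.
Qed.

(** S can be recovered from the shifted pair. Hence the kernel in [construction_cond_distribution],
    although written with S, is almost everywhere a function of that pair. *)
Lemma ae_center : {ae P, forall w, voronoi_center0 (ZS w).2 = (- S w)%R}.
Proof.
apply: ae_P0_P; move: S_cell ae_cube_process0; apply: filterS2 => w.
move=> DS N0; have [s Ss] := zero_cell_lattice DS; move: DS; rewrite Ss.
by move/(zero_cellE s N0).
Qed.

Let mW' : measurable_fun setT (fun p : Omega * Rd => (Z p.1 p.2, p.2)).
Proof. exact: measurable_fun_pair. Qed.

(** Normalization of [k] at nonzero measures suffices: shifts keep the total mass of [xi0], which is
    nonzero almost everywhere. *)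
Lemma campbell_normalized (h k : (E * M) * Rd -> \bar R) :
  measurable_fun setT h -> (forall p, 0 <= h p) ->
  measurable_fun setT k -> (forall p, 0 <= k p) ->
  (forall z : E * M, z.2 setT != 0 -> \int[z.2]_s k (z, s) = 1) ->
  campbell theta P0 X0 xi0 (fun x => h (x.1, x.2.1) * k (x.1, x.2.2)) =
  \int[P0]_w \int[lambda]_t h (Z w t, t).
Proof.
move=> mh h0 mk k0 k1.
pose u (z : E * M) := \int[z.2]_s k (z, s).
have mu : measurable_fun setT u.
  by apply: (measurable_integral_lfmeasure measurable_snd (f := k)).
have u0 z : 0 <= u z by apply: integral_ge0.
rewrite /campbell.
transitivity (\int[P0]_w \int[lambda]_t (h (Z w t, t) * u (Z w t))).
  apply: eq_integral => w _; apply: eq_integral => t _.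
  by rewrite /u -ge0_integralZl//; exact: (measurable_fun_pair2 (Z w t) mk).
have mhZ := measurableT_comp mh mW'.
have muZ : measurable_fun setT (fun p : Omega * Rd => u (Z p.1 p.2)).
  exact: (measurableT_comp mu mZ).
apply: ge0_ae_eq_integral => //.
- apply: (measurable_lebesgue_integral
    (g := fun p => h (Z p.1 p.2, p.2) * u (Z p.1 p.2))).
    exact: emeasurable_funM.
  by move=> p; rewrite mule_ge0.
- exact: (measurable_lebesgue_integral mhZ (fun p => h0 _)).
- by move=> w _; apply: integral_ge0 => t _; rewrite mule_ge0.
- by move=> w _; apply: integral_ge0.
- apply: filterS ae_xi0_neq0 => w xi_neq0 _; apply: eq_integral => t _.
  have z0 : (Z w t).2 setT != 0.
    by rewrite [(Z w t).2]/(shift_measure _ _) shift_measureT.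
  by rewrite /u (k1 _ z0) mule1.
Qed.

Let m_weight : measurable_fun setT
  (fun p : (E * M) * Rd => voronoi_weight p.1.2 p.2).
Proof. exact: measurable_voronoi_weight. Qed.

Let mx1 : measurable_fun setT (fun x : (E * M) * (Rd * Rd) => (x.1, x.2.1)).
Proof.
apply: measurable_fun_pair => //.
exact: (measurableT_comp measurable_fst measurable_snd).
Qed.

Let mx2 : measurable_fun setT (fun x : (E * M) * (Rd * Rd) => (x.1, x.2.2)).
Proof.
apply: measurable_fun_pair => //.
exact: (measurableT_comp measurable_snd measurable_snd).
Qed.

Let weight1 (z : E * M) : z.2 setT != 0 -> \int[z.2]_s voronoi_weight z.2 s = 1.
Proof. exact: integral_voronoi_weight. Qed.

(** The weight is attached to t and [G] to s; after the swap the weight depends on s and integrates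
    to 1. *)
Lemma integral_weighted_const (G : (E * M) * Rd -> \bar R) :
  measurable_fun setT G -> (forall p, 0 <= G p) ->
  \int[P0]_w \int[lambda]_t (voronoi_weight (Z w t).2 t *
    \int[(Z w t).2]_s G (Z w t, s)) =
  \int[P0]_w \int[lambda]_t G (Z w t, t).
Proof.
move=> mG G0.
rewrite -(campbell_normalized mG G0 m_weight _ weight1); last first.
  by move=> p; exact: voronoi_weight_ge0.
transitivity (campbell theta P0 X0 xi0
    (fun x => voronoi_weight x.1.2 x.2.1 * G (x.1, x.2.2))).
  apply: eq_integral => w _; apply: eq_integral => t _.
  rewrite -ge0_integralZl ?voronoi_weight_ge0//.
  exact: (measurable_fun_pair2 (Z w t) mG).
rewrite (campbell_swap thetaD measurable_theta mX0 mxi0 sigma_finite0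
  mass_stationary0); last 2 first.
- apply: emeasurable_funM; first exact: (measurableT_comp m_weight mx1).
  exact: (measurableT_comp mG mx2).
- by move=> x; rewrite mule_ge0 ?voronoi_weight_ge0.
apply: eq_integral => w _; apply: eq_integral => t _.
by apply: eq_integral => s _; rewrite muleC.
Qed.

(** [F] ignores the value of T, so [integral_construction] leaves only kappa in t, which
    [integral_weighted_const] removes. *)
Lemma refined_campbell (g : (E * M) * Rd -> \bar R) :
  measurable_fun setT g -> (forall p, 0 <= g p) ->
  \int[P]_w \int[(ZS w).2]_s g (ZS w, s) = \int[P0]_w \int[lambda]_t g (Z w t, t).
Proof.
move=> mg g0.
pose F (p : (E * M) * Rd) := \int[p.1.2]_s g (p.1, s).
have mF : measurable_fun setT F.
  apply: (measurable_integral_lfmeasure m_zeta (f := fun q => g (q.1.1, q.2))) => //.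
  apply: (measurableT_comp mg); apply: measurable_fun_pair => //.
  exact: (measurableT_comp measurable_fst measurable_fst).
have F0 p : 0 <= F p by apply: integral_ge0.
by rewrite -(integral_weighted_const mg g0); exact: (integral_construction mF F0).
Qed.

Lemma construction_palm : palm_version theta P0 X0 xi0 P (fun w => (ZS w).1)
  (fun w => (ZS w).2).
Proof.
move=> f mf f0 B mB B0 Boo.
(* At [(z_t, t)] the shift by t undoes the one by [- t], so [g] is the indicator of [B] at t times
   [f] at Y. *)
pose g (p : (E * M) * Rd) := (\1_B p.2)%:E * f (shift_pair theta p.2 p.1).
have mg : measurable_fun setT g.
  apply: emeasurable_funM.
    by apply/measurable_EFinP; exact: (measurableT_comp (measurable_indic mB)).
  apply: (measurableT_comp mf); exact: measurable_shift_pair.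
have g0 p : 0 <= g p by rewrite mule_ge0 ?lee_fin.
have : \int[P]_w \int[(ZS w).2]_s g (ZS w, s) = lambda B * \int[P0]_w f (Y w).
  rewrite (refined_campbell mg g0) -ge0_integralZl//; last exact: (measurableT_comp mf mY).
  apply: eq_integral => w _.
  rewrite (_ : lambda B = \int[lambda]_t (\1_B t)%:E); last first.
    by rewrite integral_indic// setIT.
  rewrite -ge0_integralZr//; last exact/measurable_EFinP/measurable_indic.
  apply: eq_integral => t _; rewrite /g -shift_pairD// subrr shift_pair0//.
move=> gE.
rewrite [X in _ = X / _](_ : _ = lambda B * \int[P0]_w f (Y w)).
  rewrite muleAC divee ?mul1e//; first by rewrite ge0_fin_numE.
  by rewrite gt_eqF.
by rewrite -gE; apply: eq_integral => w _; rewrite integral_indicM.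
Qed.

Lemma construction_stationary :
  stationary theta P (fun w => (ZS w).1) (fun w => (ZS w).2).
Proof.
move=> a A mA.
have m1A : measurable_fun setT (fun z : E * M => (\1_A z)%:E : \bar R).
  exact/measurable_EFinP/measurable_indic.
(* The right-hand side is free of [b]; stationarity compares [b = a] with [b = 0]. *)
have PE b : P ((fun w => shift_pair theta b (ZS w)) @^-1` A) =
    \int[P0]_w \int[lambda]_t (voronoi_weight (Z w t).2 t * (\1_A (Z w t))%:E).
  pose k (p : (E * M) * Rd) :=
    voronoi_weight (shift_pair theta b p.1).2 (p.2 - b)%R.
  have mb : measurable_fun setT (fun p : (E * M) * Rd => shift_pair theta b p.1).
    exact: measurable_shift_pair.
  have mk : measurable_fun setT k.
    apply: measurable_voronoi_weight; last exact: measurable_funD_rV.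
    exact: (measurableT_comp measurable_snd mb).
  have k0 p : 0 <= k p by exact: voronoi_weight_ge0.
  have k1 (z : E * M) : z.2 setT != 0 -> \int[z.2]_s k (z, s) = 1.
    move=> z0; rewrite -(integral_shift_measure b z.2
      (f := voronoi_weight (shift_pair theta b z).2)).
    - by apply: integral_voronoi_weight => //; rewrite shift_measureT.
    - exact: measurable_voronoi_weight.
    - by move=> x; exact: voronoi_weight_ge0.
  have mbS : measurable_fun setT (fun w => shift_pair theta b (ZS w)).
    by apply: measurable_shift_pair => //; exact: measurable_ZS.
  pose g (p : (E * M) * Rd) := (\1_A (shift_pair theta b p.1))%:E * k p.
  have mg : measurable_fun setT g.
    by apply: emeasurable_funM => //; exact: (measurableT_comp m1A mb).
  have g0 p : 0 <= g p by rewrite mule_ge0// lee_fin.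
  transitivity (\int[P]_w \int[(ZS w).2]_s g (ZS w, s)).
    rewrite -[X in P X]setIT -integral_indic//; last first.
      by rewrite -[X in measurable X]setTI; exact: mbS.
    apply: ge0_ae_eq_integral => //.
    - apply/measurable_EFinP; apply: measurable_indic.
      by rewrite -[X in measurable X]setTI; exact: mbS.
    - have mS2 : measurable_fun setT (fun w => (ZS w).2).
        exact: (measurableT_comp measurable_snd measurable_ZS).
      apply: (measurable_integral_lfmeasure mS2 (f := fun q => g (ZS q.1, q.2))) => //.
      apply: (measurableT_comp mg); apply: measurable_fun_pair => //.
      exact: (measurableT_comp measurable_ZS).
    - by move=> w _; apply: integral_ge0 => t _; exact: g0.
    - apply: filterS ae_ZS_neq0 => w z0 _.
      transitivity ((\1_A (shift_pair theta b (ZS w)))%:E *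
          \int[(ZS w).2]_s k (ZS w, s)).
        by rewrite (k1 _ z0) mule1.
      rewrite -ge0_integralZl ?lee_fin//.
      exact: (measurable_fun_pair2 (ZS w) mk).
  rewrite (refined_campbell mg g0); apply: eq_integral => w _.
  pose r (t : Rd) := voronoi_weight (Z w t).2 t * (\1_A (Z w t))%:E.
  have mZw : measurable_fun setT (fun t : Rd => Z w t).
    exact: (measurable_fun_pair2 w mZ).
  have mr : measurable_fun setT r.
    apply: emeasurable_funM; last exact: (measurableT_comp m1A mZw).
    apply: measurable_voronoi_weight => //.
    exact: (measurableT_comp measurable_snd mZw).
  have r0 t : 0 <= r t by rewrite mule_ge0 ?voronoi_weight_ge0 ?lee_fin//.
  (* Shifting [z_t] by [b] gives [z_(t - b)], so the substitution of [t - b] for t absorbs [b]. *)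
  rewrite -[RHS](integral_lebesgue_rV_translate (- b)%R mr r0).
  apply: eq_integral => t _; rewrite /g /k /r muleC -shift_pairD//.
  by rewrite opprD opprK addrC.
have E0 : (fun w => shift_pair theta 0 (ZS w)) = (fun w => ZS w).
  by apply/funext => w; exact: shift_pair0.
have := PE 0%R; rewrite E0 => P0E.
exact: (etrans (PE a) (esym P0E)).
Qed.

Lemma construction_cond_distribution :
  cond_distribution P (fun w => ZS w) T
    (fun w => cond_measure (shift_measure (- S w) (ZS w).2) unit_cube).
Proof.
move=> B mB; have mQ := @measurable_unit_cube R d.
pose k (z : E * M) := cond_measure (center_measure z.2) unit_cube B.
have mcond dX (X : measurableType dX) (mu : X -> M) : measurable_fun setT mu ->
    measurable_fun setT (fun x => cond_measure (mu x) unit_cube B).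
  move=> mmu; apply: emeasurable_funM.
    by apply: (measurableT_comp (measurable_lfmeasure_eval _) mmu); exact: measurableI.
  apply: measurable_funV.
  exact: (measurableT_comp (measurable_lfmeasure_eval mQ) mmu).
have mk : measurable_fun setT k.
  by apply: mcond; exact: (measurable_center_measure measurable_snd).
have k0 z : 0 <= k z by rewrite mule_ge0 ?inve_ge0.
have mS2 : measurable_fun setT (fun w => (ZS w).2).
  exact: (measurableT_comp measurable_snd measurable_ZS).
have Kk : {ae P, forall w,
    cond_measure (shift_measure (- S w) (ZS w).2) unit_cube B = k (ZS w)}.
  by apply: filterS ae_center => w cw; rewrite /k /center_measure cw.
split; first by exists k.
move=> A mA.
have mZA : measurable ((fun w => ZS w) @^-1` A).
  by rewrite -[X in measurable X]setTI; exact: measurable_ZS.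
pose one_A (z : E * M) : \bar R := (\1_A z)%:E.
have m1A : measurable_fun setT one_A by exact/measurable_EFinP/measurable_indic.
have A0 z : 0 <= one_A z by rewrite lee_fin.
pose F (p : (E * M) * Rd) : \bar R := one_A p.1 * (\1_B p.2)%:E.
have mF : measurable_fun setT F.
  apply: emeasurable_funM; first exact: (measurableT_comp m1A measurable_fst).
  by apply/measurable_EFinP; exact: (measurableT_comp (measurable_indic mB)).
have F0 p : 0 <= F p by rewrite mule_ge0 ?lee_fin.
(* [F] with the indicator of [B] at T replaced by its claimed conditional expectation. *)
pose F' (p : (E * M) * Rd) : \bar R := one_A p.1 * k p.1.
have mF' : measurable_fun setT F'.
  apply: emeasurable_funM; first exact: (measurableT_comp m1A measurable_fst).
  exact: (measurableT_comp mk measurable_fst).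
have F'0 p : 0 <= F' p by rewrite mule_ge0.
transitivity (\int[P]_w F (ZS w, T w)).
  have mTB : measurable (T @^-1` B).
    by rewrite -[X in measurable X]setTI; exact: mT.
  rewrite -[X in P X]setIT -integral_indic//; last exact: measurableI.
  by apply: eq_integral => w _; rewrite indicI /F /= EFinM.
transitivity (\int[P]_w F' (ZS w, T w)); last first.
  rewrite [RHS]integral_indicM; apply: ge0_ae_eq_integral => //.
  - apply: (measurableT_comp mF'); apply: measurable_fun_pair => //.
    exact: measurable_ZS.
  - apply: emeasurable_funM; first exact/measurable_EFinP/measurable_indic.
    apply: mcond; apply: measurable_shift_measure => //.
    exact: measurable_funN_rV.
  - by move=> w _; rewrite mule_ge0 ?lee_fin// mule_ge0// inve_ge0.
  - by apply: filterS Kk => w -> _.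
rewrite (integral_construction mF F0) (integral_construction mF' F'0).
have mwF := measurable_weighted mF; have wF0 p := weighted_ge0 p F0.
(* Used backwards: kappa appears in t and [weighted F] moves to s. Its integral over s is the
   indicator of [A] times [k], by [integral_voronoi_weight_indic]. *)
rewrite -(integral_weighted_const mwF wF0).
apply: eq_integral => w _; apply: eq_integral => t _; congr (_ * _).
move: (Z w t) => z; rewrite /F' /k -integral_voronoi_weight_indic//.
rewrite -ge0_integralZl//; last 2 first.
- apply: emeasurable_funM.
    exact: (measurable_fun_pair2 z m_weight).
  apply/measurable_EFinP.
  exact: (measurableT_comp (measurable_indic mB) (measurable_subr _)).
- by move=> s _; rewrite mule_ge0 ?voronoi_weight_ge0 ?lee_fin.
by apply: eq_integral => s _; rewrite /weighted/F/= muleCA.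
Qed.

(** [H n] has P-integral [lambda (cube n)] times the P0-mass of [Y] in [A n], which is finite, and
    it increases to the total mass, positive almost everywhere. Its superlevel sets thus cover
    almost everything and have finite mass. *)
Lemma construction_sigma_finite :
  sigma_finite setT (pushforward P (fun w => ZS w)).
Proof.
have /sigma_finiteP[A [AT ndA Afin]] :
    sigma_finite setT (image_measure P0 mY) by exact: sigma_finite0.
pose g n (p : (E * M) * Rd) : \bar R :=
  (\1_(cube n) p.2)%:E * (\1_(A n) (shift_pair theta p.2 p.1))%:E.
have mA n : measurable (A n) by have [] := Afin n.
have mg n : measurable_fun setT (g n).
  have mC : measurable_fun setT (\1_(cube n) : Rd -> R).
    exact: measurable_indic (@measurable_cube R d n).
  apply: emeasurable_funM; apply/measurable_EFinP.
    exact: (measurableT_comp mC measurable_snd).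
  have ms : measurable_fun setT
      (fun p : (E * M) * Rd => shift_pair theta p.2 p.1).
    exact: measurable_shift_pair.
  exact: (measurableT_comp (measurable_indic (mA n)) ms).
have g0 n p : 0 <= g n p by rewrite mule_ge0 ?lee_fin.
have ndg p : nondecreasing_seq (g ^~ p).
  move=> m n mn; rewrite /g -!EFinM lee_fin; apply: ler_pM => //;
    rewrite !indicE ler_nat; case: (boolP (_ \in _)) => // /set_mem xm;
    rewrite mem_set//; first exact: (nondecreasing_cube mn).
  exact: (subsetPset _ _ (ndA _ _ mn)).
have limg p : limn (g ^~ p) = 1.
  apply/cvg_lim => //; apply: cvg_near_cst.
  have [m _ xm] : (\bigcup_n cube n) p.2 by rewrite bigcup_cube.
  have [m' _ xm'] : (\bigcup_n A n) (shift_pair theta p.2 p.1) by rewrite -AT.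
  near=> n; rewrite /g !indicE !mem_set ?mul1e//.
    have mn : (m' <= n)%N by near: n; exact: nbhs_infty_ge.
    exact: (subsetPset _ _ (ndA _ _ mn)).
  by apply: (nondecreasing_cube _ xm); near: n; exact: nbhs_infty_ge.
pose H n (z : E * M) := \int[z.2]_s g n (z, s).
have mH n : measurable_fun setT (H n).
  exact: (measurable_integral_lfmeasure measurable_snd (mg n)).
have H0 n z : 0 <= H n z by exact: integral_ge0.
have ndH z : nondecreasing_seq (H ^~ z).
  move=> m n mn; apply: ge0_le_integral => //.
  - exact: (measurable_fun_pair2 z (mg m)).
  - exact: (measurable_fun_pair2 z (mg n)).
  - by move=> s _; exact: ndg.
have limH z : limn (H ^~ z) = z.2 setT.
  rewrite /H -monotone_convergence//; last first.
    by move=> n; exact: (measurable_fun_pair2 z (mg n)).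
  under eq_integral do rewrite limg.
  by rewrite integral_cst// mul1e.
have intH n : \int[P]_w H n (ZS w) < +oo.
  rewrite (refined_campbell (mg n) (g0 n)).
  have -> : \int[P0]_w \int[lambda]_t g n (Z w t, t) =
      \int[P0]_w (lambda (cube n) * (\1_(A n) (Y w))%:E).
    apply: eq_integral => w _.
    rewrite -[X in lambda X]setIT -integral_indic//; last exact: measurable_cube.
    rewrite -ge0_integralZr ?lee_fin//; last first.
      by apply/measurable_EFinP; apply: measurable_indic; exact: measurable_cube.
    by apply: eq_integral => t _; rewrite /g -shift_pairD// subrr shift_pair0.
  have mAY : measurable ((fun w => Y w) @^-1` A n).
    by rewrite -[X in measurable X]setTI; exact: mY.
  rewrite ge0_integralZl//; last first.
    exact/measurable_EFinP/(measurableT_comp (measurable_indic (mA n)) mY).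
  rewrite -[X in _ * X](_ : P0 ((fun w => Y w) @^-1` A n) = _); last first.
    by rewrite -[X in P0 X]setIT -integral_indic.
  by rewrite lte_mul_pinfty ?ge0_fin_numE ?lebesgue_cube_lty//; have [] := Afin n.
pose N : set (E * M) := [set z : E * M | z.2 setT = 0].
have mN : measurable N.
  rewrite -[X in measurable X]setTI.
  have mT2 : measurable_fun setT (fun z : E * M => z.2 setT).
    exact: (measurableT_comp (measurable_lfmeasure_eval measurableT) measurable_snd).
  exact: (mT2 measurableT [set 0%E] (emeasurable_set1 _)).
pose B n : set (E * M) := [set z | (n.+1%:R^-1)%:E <= H n z].
have mB n : measurable (B n).
  rewrite -[X in measurable X]setTI; exact: emeasurable_fun_c_infty.
(* No [H n] is positive where the measure vanishes, so this null event is added to each set. *)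
exists (fun n => N `|` B n).
  apply/seteqP; split => // z _.
  have [z0|z0] := eqVneq (z.2 setT) 0; first by exists 0%N => //; left.
  have [m Hm] : exists m, 0 < H m z.
    apply: contrapT => /forallNP Hz; move/eqP: z0; apply; rewrite -limH.
    rewrite (_ : H ^~ z = fun=> 0) ?lim_cst//; apply/funext => n.
    by apply/eqP; rewrite eq_le H0 andbT leNgt; apply/negP; exact: Hz.
  have [r r0 rH] : exists2 r : R, (0 < r)%R & r%:E <= H m z.
    case: (H m z) Hm => [r|_|//]; last by exists 1%R; rewrite ?leey.
    by rewrite lte_fin => r0; exists r.
  (* One index serves for two demands: [H j] is at least [H m], hence at least [r], and [1 / j.+1]
     is at most [r]. *)
  pose j := maxn m (Num.truncn r^-1).
  exists j => //; right; apply: (le_trans _ (ndH z _ _ (leq_maxl m _))).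
  apply: (le_trans _ rH); rewrite lee_fin invf_ple ?posrE ?ltr0n//.
  rewrite ltW// (lt_le_trans (truncnS_gt _))// ler_nat ltnS; exact: leq_maxr.
have mZSi C : measurable C -> measurable ((fun w => ZS w) @^-1` C).
  by move=> mC; rewrite -[X in measurable X]setTI; exact: measurable_ZS.
move=> n; split; first exact: measurableU.
have PN : P ((fun w => ZS w) @^-1` N) = 0.
  have [K [mK K0 NK]] := ae_ZS_neq0.
  apply: (subset_measure0 (mZSi _ mN) mK _ K0) => w Nw; apply: NK => /=.
  by rewrite [(ZS w).2 setT]Nw eqxx.
suff PB : P ((fun w => ZS w) @^-1` B n) < +oo.
  apply: (le_lt_trans (measureU2 P (mZSi _ mN) (mZSi _ (mB n)))).
  by rewrite [X in X + _]PN add0e.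
have n0 : (0 < n.+1%:R^-1 :> R)%R by rewrite invr_gt0 ltr0n.
have m1 : measurable_fun setT (fun w => (\1_(B n) (ZS w))%:E : \bar R).
  exact/measurable_EFinP/(measurableT_comp (measurable_indic (mB n)) measurable_ZS).
have n0' : 0 <= (n.+1%:R^-1)%:E :> \bar R by rewrite lee_fin ltW.
(* Markov's inequality by contradiction: infinite mass of [B n] would make the integral of [H n]
   infinite. *)
rewrite ltey; apply/eqP => PB.
have := intH n; rewrite ltNge => /negP; apply.
rewrite (_ : +oo = \int[P]_w ((n.+1%:R^-1)%:E * (\1_(B n) (ZS w))%:E)); last first.
  rewrite ge0_integralZl//.
  rewrite -[X in _ * X](_ : P ((fun w => ZS w) @^-1` B n) = _); last first.
    by rewrite -[X in P X]setIT -integral_indic//; exact: mZSi.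
  by rewrite [X in _ * X]PB gt0_muley ?lte_fin.
apply: ge0_le_integral => //.
- exact: measurable_funeM.
- exact: (measurableT_comp (mH n) measurable_ZS).
- move=> w _; rewrite indicE; case: (boolP (ZS w \in B n)) => [/set_mem|_].
    by rewrite mule1.
  by rewrite mule0.
Unshelve. all: by end_near. Qed.

End construction.

Local Close Scope ereal_scope.

Theorem theorem3 (R : realType) (d : nat) (d_gt0 : (0 < d)%N)
  (dE : measure_display) (E : measurableType dE)
  (theta : 'rV[R]_d -> E -> E)
  (theta0 : forall x, theta 0 x = x)
  (thetaD : forall s t x, theta (s + t) x = theta s (theta t x))
  (measurable_theta :
    measurable_fun setT (fun p : 'rV[R]_d * E => theta p.1 p.2))
  (dO : measure_display) (Omega : measurableType dO)
  (P0 : {measure set Omega -> \bar R})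
  (X0 : Omega -> E) (measurable_X0 : measurable_fun setT X0)
  (xi0 : Omega -> lfmeasure R d) (measurable_xi0 : measurable_fun setT xi0)
  (sigma_finite0 :
    sigma_finite setT (pushforward P0 (fun w => (X0 w, xi0 w))))
  (support0 : {ae P0, forall w, msupport (xi0 w) 0})
  (mass_stationary0 : mass_stationary theta P0 X0 xi0)
  (hull0 : {ae P0, forall w, convex_hull (msupport (xi0 w)) = setT})
  (T : Omega -> 'rV[R]_d) (measurable_T : measurable_fun setT T)
  (T_cube : forall w, unit_cube (T w))
  (T_uniform : cond_distribution P0 (fun w => (X0 w, xi0 w)) T
    (fun _ => cond_measure (lebesgue_rV R d) unit_cube))
  (S : Omega -> 'rV[R]_d) (measurable_S : measurable_fun setT S)
  (S_cell : {ae P0, forall w, zero_cell (shift_measure (- T w) (xi0 w)) (S w)})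
  (S_uniform : cond_distribution P0 (fun w => ((X0 w, xi0 w), T w)) S
    (fun w => cond_measure counting (zero_cell (shift_measure (- T w) (xi0 w)))))
  (P : {measure set Omega -> \bar R})
  (P_density : forall A, measurable A ->
    P A = (\int[P0]_(w in A)
      (counting (zero_cell (shift_measure (- T w) (xi0 w)))
        / shift_measure (- T w) (xi0 w) unit_cube))%E) :
  let X w := theta (S w) (theta (- T w) (X0 w)) in
  let xi w := shift_measure (S w) (shift_measure (- T w) (xi0 w)) in
  [/\ sigma_finite setT (pushforward P (fun w => (X w, xi w))),
      stationary theta P X xi,
      cond_distribution P (fun w => (X w, xi w)) T
        (fun w => cond_measure (shift_measure (- S w) (xi w)) unit_cube) &
      palm_version theta P0 X0 xi0 P X xi].

Proof.
move=> X xi; split.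
- exact: (construction_sigma_finite d_gt0 theta0 thetaD measurable_theta
    measurable_X0 measurable_xi0 sigma_finite0 support0 measurable_T T_cube
    T_uniform measurable_S S_cell S_uniform P_density mass_stationary0).
- exact: (construction_stationary d_gt0 theta0 thetaD measurable_theta
    measurable_X0 measurable_xi0 sigma_finite0 support0 measurable_T T_cube
    T_uniform measurable_S S_cell S_uniform P_density mass_stationary0).
- exact: (construction_cond_distribution d_gt0 thetaD measurable_theta
    measurable_X0 measurable_xi0 sigma_finite0 support0 measurable_T T_cube
    T_uniform measurable_S S_cell S_uniform P_density mass_stationary0).
- exact: (construction_palm d_gt0 theta0 thetaD measurable_theta
    measurable_X0 measurable_xi0 sigma_finite0 support0 measurable_T T_cube
    T_uniform measurable_S S_cell S_uniform P_density mass_stationary0).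
Qed.
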